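(* Let $\{\omega^t\}_{t\in[0,1]}$ be a family of doubling weights on $\mathbb{T}$ with doubling constants at most $C_{\rm dbl}$ for all $t$, and suppose $(t,x)\mapsto\omega^t(x)$ is measurable. (1) Fix $1\le p\le\infty$ and suppose $\omega^t\in A_p^d$ with $A_p^d(\omega^t)\le V_{p,d}$ for all $t$. Then the translation-average $\omega(x)=\int_0^1\omega^t(x+t)\,dt$ belongs to $A_p(\mathbb{T})$, with $A_p(\omega)$ bounded by a constant depending only on $p$, $V_{p,d}$ and $C_{\rm dbl}$. (2) Fix $1<p\le\infty$ and suppose $\omega^t\in RH_p^d$ with $RH_p^d(\omega^t)\le V_{p,d}$ for all $t$. Then $\omega\in RH_p(\mathbb{T})$ with $RH_p(\omega)$ bounded by a constant depending only on $p$, $V_{p,d}$ and $C_{\rm dbl}$.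
   Context: $\mathbb{T}$ is the circle $[0,1]$ with endpoints identified; $x+t$ taken mod 1. A weight is a nonnegative locally integrable function. $\omega$ is doubling with constant $C$ if $\int_{\widetilde Q}\omega\le C\int_Q\omega$ for every interval $Q\subset\mathbb{T}$, $\widetilde Q$ being the interval with the same midpoint and twice the length. Dyadic intervals $\mathcal{D}=\{[0,1]\}\cup\{[j2^{-k},(j+1)2^{-k})\}$; $-\!\!\!\!\!\!\int_E f=\frac1{|E|}\int_E f$. $A_p(\omega)$: for $1<p<\infty$, $\sup_Q(-\!\!\!\!\!\!\int_Q\omega)(-\!\!\!\!\!\!\int_Q\omega^{-1/(p-1)})^{p-1}$; $A_1(\omega)=\sup_Q(-\!\!\!\!\!\!\int_Q\omega)/\operatorname{ess\,inf}_Q\omega$; $A_\infty(\omega)=\sup_Q(-\!\!\!\!\!\!\int_Q\omega)\exp(-\!\!\!\!\!\!\int_Q\log(1/\omega))$. $RH_p(\omega)=\sup_Q(-\!\!\!\!\!\!\int_Q\omega^p)^{1/p}(-\!\!\!\!\!\!\int_Q\omega)^{-1}$ for $1<p<\infty$, $RH_\infty(\omega)=\sup_Q(\operatorname{ess\,sup}_Q\omega)(-\!\!\!\!\!\!\int_Q\omega)^{-1}$. Suprema are over all intervals $Q\subset\mathbb{T}$; the dyadic versions $A_p^d$, $A_p^d(\omega)$ take suprema over $I\in\mathcal{D}$ only; $RH_p^d$ additionally requires dyadic doubling ($\int_{\widetilde I}\omega\le C\int_I\omega$, $\widetilde I$ the dyadic interval of length $2|I|$ containing $I$), and $RH_p^d(\omega)$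 is the larger of the dyadic supremum and the dyadic doubling constant.
   Formalization: The formal theorem additionally assumes that the translation-average ω is integrable on T, i.e. is itself a weight; this can fail otherwise (ω^t constant equal to 1/t gives ω = +∞). Measurability is taken in the Borel sense. *)

(* Defs.v *)
(* Weights on the circle T = R/Z are represented as
   1-periodic functions on R; integrals are Lebesgue integrals on R. *)
From HB Require Import structures.
From mathcomp Require Import all_boot all_order all_algebra.
From mathcomp Require Import all_classical all_reals all_analysis ess_sup_inf.
Set Implicit Arguments.
Unset Strict Implicit.
Unset Printing Implicit Defensive.
Import Order.TTheory GRing.Theory Num.Theory.
Import numFieldNormedType.Exports.
Local Open Scope classical_set_scope.
Local Open Scope ring_scope.

Section Weights.
Context {R : realType}.
Local Open Scope ereal_scope.

Definition integ (f : R -> \bar R) (a b : R) : \bar R :=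
  \int[@lebesgue_measure R]_(x in `[a, b]) f x.

Definition avg (f : R -> \bar R) (a b : R) : \bar R :=
  ((b - a)^-1)%:E * integ f a b.

Definition essinf (f : R -> \bar R) (a b : R) : \bar R :=
  ess_inf (@lebesgue_measure R) (fun x => if x \in `[a, b] then f x else +oo).
Definition esssup (f : R -> \bar R) (a b : R) : \bar R :=
  ess_sup (@lebesgue_measure R) (fun x => if x \in `[a, b] then f x else -oo).

Definition negpow (s : R) (y : \bar R) : \bar R :=
  match y with
  | r%:E => if r == 0%R then +oo else (r `^ (- s))%:E
  | +oo => 0
  | -oo => +oo
  end.

Definition einv (y : \bar R) : \bar R :=
  match y with
  | r%:E => if r == 0%R then +oo else (r^-1)%:E
  | +oo => 0
  | -oo => 0
  end.

(* The A_p quantity of f on the interval [a,b], for p in [1, +oo].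
   Convention: it is +oo whenever the "reciprocal" factor is +oo
   (ess inf = 0, average of f^{-1/(p-1)} = +oo, exp(avg log(1/f)) = +oo). *)
Definition Apchar (p : \bar R) (f : R -> \bar R) (a b : R) : \bar R :=
  match p with
  | +oo =>
      let E := expeR (avg (fun x => - lne (f x)) a b) in
      if E == +oo then +oo else avg f a b * E
  | r%:E =>
      if r == 1%R then
        let m := essinf f a b in
        if m == 0 then +oo else avg f a b * einv m
      else
        let N := avg (fun x => negpow (r - 1)^-1 (f x)) a b in
        if N == +oo then +oo else avg f a b * poweR N (r - 1)
  | -oo => +oo
  end.

(* RH_p quantity of f on [a,b] bounded by V, for p in (1, +oo]
   (written multiplicatively: numerator <= V * average). *)
Definition RHbound (p : \bar R) (V : R) (f : R -> \bar R) (a b : R) : Prop :=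
  match p with
  | +oo => esssup f a b <= V%:E * avg f a b
  | r%:E => poweR (avg (fun x => poweR (f x) r) a b) r^-1 <= V%:E * avg f a b
  | -oo => False
  end.

Definition is_weight (f : R -> R) : Prop :=
  [/\ (forall x, (0 <= f x)%R),
      (forall x : R, f (x + 1)%R = f x),
      measurable_fun setT f &
      (@lebesgue_measure R).-integrable `[0%R, 1%R] (EFin \o f)].

(* Doubling with constant C: arcs Q = [a, a+l], 0 < l <= 1; the doubled arc has
   the same midpoint and length min(2l, 1) (the whole circle when 2l >= 1). *)
Definition doubling (C : R) (f : R -> \bar R) : Prop :=
  forall a l : R, (0 < l)%R -> (l <= 1)%R ->
    let c := (a + l / 2)%R in
    let h := Num.min l (2^-1)%R in
    integ f (c - h)%R (c + h)%R <= C%:E * integ f a (a + l)%R.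

(* dyadic interval I_{k,j} = [j 2^-k, (j+1) 2^-k), j < 2^k
   (k = 0 gives [0,1], which has the same integrals as [0,1)) *)
Definition dyl (k j : nat) : R := (j%:R / 2 ^+ k)%R.
Definition dyr (k j : nat) : R := (j.+1%:R / 2 ^+ k)%R.

Definition Apd_bound (p : \bar R) (V : R) (f : R -> \bar R) : Prop :=
  forall k j : nat, (j < 2 ^ k)%N -> Apchar p f (dyl k j) (dyr k j) <= V%:E.

Definition Ap_bound (p : \bar R) (K : R) (f : R -> \bar R) : Prop :=
  forall a l : R, (0 < l)%R -> (l <= 1)%R -> Apchar p f a (a + l)%R <= K%:E.

(* RH_p^d(f) <= V : dyadic reverse Hoelder bound and dyadic doubling with
   constant V (parent of I_{k+1,j} is I_{k, j/2}) *)
Definition RHd_bound (p : \bar R) (V : R) (f : R -> \bar R) : Prop :=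
  (forall k j : nat, (j < 2 ^ k)%N -> RHbound p V f (dyl k j) (dyr k j)) /\
  (forall k j : nat, (j < 2 ^ k.+1)%N ->
     integ f (dyl k j./2) (dyr k j./2) <= V%:E * integ f (dyl k.+1 j) (dyr k.+1 j)).

Definition RH_bound (p : \bar R) (K : R) (f : R -> \bar R) : Prop :=
  forall a l : R, (0 < l)%R -> (l <= 1)%R -> RHbound p K f a (a + l)%R.

Definition transl_avg (w : R -> R -> R) (x : R) : \bar R :=
  \int[@lebesgue_measure R]_(t in `[0%R, 1%R]) (w t (x + t)%R)%:E.

Definition family_hyp (C : R) (w : R -> R -> R) : Prop :=
  [/\ (forall t, t \in `[0%R, 1%R] -> is_weight (w t)),
      (forall t, t \in `[0%R, 1%R] -> doubling C (EFin \o w t)),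
      measurable_fun (`[0%R, 1%R] `*` [set: R] : set (R * R)) (fun z : R * R => w z.1 z.2) &
      (* omega is itself a weight: it is integrable on T *)
      \int[@lebesgue_measure R]_(x in `[0%R, 1%R]) transl_avg w x < +oo].

End Weights.

(* Main.v *)
Require Import Defs.
From HB Require Import structures.
From mathcomp Require Import all_boot all_order all_algebra.
From mathcomp Require Import all_classical all_reals all_analysis ess_sup_inf.
From mathcomp Require Import measurable_realfun ring lra.
Set Implicit Arguments.
Unset Strict Implicit.
Unset Printing Implicit Defensive.
Import Order.TTheory GRing.Theory Num.Theory.
Import numFieldNormedType.Exports.
Local Open Scope classical_set_scope.
Local Open Scope ring_scope.
Local Open Scope ereal_scope.

(** Each of the five conditions says that, on every interval, a convex function
    phi of the normalised weight w / avg w has bounded average: phi(y) is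
    y^(-1/(p-1)) for A_p, (c - y)^+ for A_1, y - 1 - ln y for A_oo, y^p for RH_p
    and (y - c)^+ for RH_oo.  An arc Q is covered by two adjacent dyadic
    intervals of comparable length, and doubling makes their averages comparable
    to the average m_t of w^t on Q + t, so the dyadic bounds give
    avg_(Q+t) phi(w^t / m_t) <= K uniformly in t.  With M the integral of m_t in
    t, omega / M is the average of the functions w^t(. + t) / m_t against the
    probability m_t dt / M; Jensen's inequality and Tonelli's theorem therefore
    give avg_Q phi(omega / M) <= K, and M = avg_Q omega. *)

(** Normalising by m_t separates the two coupled factors of a characteristic, the average of the
    weight and the dual factor: what remains is the integral of one convex function, and such a
    bound survives averaging in t. Nonnegativity of phi lets the integral over an arc be bounded by
    those over the two larger dyadic intervals, and puts every exchange of integrals under Tonelli.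
    For A_1 and RH_oo the test function is a hinge placed at the threshold, so the dyadic bound is K
    = 0: the factor 4 lost in passing to arcs then costs nothing, and a zero average says exactly
    that the pointwise bound holds almost everywhere. Dividing by m_t requires m_t > 0. In the A_p
    cases a vanishing average would make the dual factor infinite; but the zero weight satisfies the
    reverse Hoelder bounds, so there m_t is the average plus some eps > 0, and eps is removed at the
    end. *)

(** * Integrals of periodic functions under translation *)

Section Translation.
Context {R : realType}.
Local Notation mu := (@lebesgue_measure R).

Definition translate (c : R) : R -> measurableTypeR R := fun x => (x + c)%R.

Lemma measurable_translate (c : R) : measurable_fun setT (translate c).
Proof. by apply: measurable_funD. Qed.

(** Lebesgue measure is the only measure that gives every half-open interval its length, and
    translation preserves lengths. *)
Lemma lebesgue_measure_translate (c : R) (A : set R) : measurable A ->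
  pushforward mu (translate c) A = mu A.
Proof.
move=> mA; apply/esym.
apply: lebesgue_measure_unique => //; first exact: measurable_translate.
move=> mt _ [[a b]] _ <- /=.
rewrite /pushforward/= [X in _ = mu X](_ : _ = `](a - c)%R, (b - c)%R]%classic).
  rewrite !lebesgue_measure_itv/= !lte_fin ltrD2r.
  by case: ifP => // _; rewrite -!EFinD; congr (_%:E); lra.
by apply/seteqP; split => x /=; rewrite /translate !in_itv/=; lra.
Qed.

Lemma integ_shift (f : R -> \bar R) (a b c : R) :
  measurable_fun setT f -> (forall x, 0 <= f x) ->
  integ (fun x => f (x + c)%R) a b = integ f (a + c)%R (b + c)%R.
Proof.
move=> mf f0; rewrite /integ.
rewrite [X in integral _ X _](_ : _ = translate c @^-1` `[(a + c)%R, (b + c)%R]); last first.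
  by apply/seteqP; split => x /=; rewrite /translate !in_itv/=; lra.
rewrite -(@ge0_integral_pushforward _ _ (measurableTypeR R) (measurableTypeR R) _ (translate c) (measurable_translate c) mu _ f)//; last first.
  exact: measurable_funTS.
by apply: eq_measure_integral => [|mt A mA _];
  [exact: measurable_translate|exact: lebesgue_measure_translate].
Qed.

Lemma integ_ge0 (f : R -> \bar R) (a b : R) : (forall x, 0 <= f x) ->
  0 <= integ f a b.
Proof. by move=> f0; apply: integral_ge0. Qed.

Lemma integ_cat (f : R -> \bar R) (a b c : R) :
  measurable_fun setT f -> (forall x, 0 <= f x) -> (a <= b)%R -> (b <= c)%R ->
  integ f a c = integ f a b + integ f b c.
Proof.
move=> mf f0 ab bc; rewrite /integ.
have -> : [set` `[a, c]] = `[a, b[%classic `|` `[b, c]%classic.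
  by apply/seteqP; split => x /=; rewrite !in_itv/=;
    case: (ltP x b) => xb; lra.
rewrite ge0_integral_setU//; last 2 first.
  exact: measurable_funTS.
  by rewrite disj_set2E; apply/eqP/seteqP; split => x //= []; rewrite !in_itv/=; lra.
by rewrite integral_itv_bndo_bndc//; exact: measurable_funTS.
Qed.

Lemma integ_sub (f : R -> \bar R) (a b a' b' : R) :
  measurable_fun setT f -> (forall x, 0 <= f x) -> (a' <= a)%R -> (b <= b')%R ->
  integ f a b <= integ f a' b'.
Proof.
move=> mf f0 aa bb; apply: ge0_subset_integral => //.
  exact: measurable_funTS.
by move=> x /=; rewrite !in_itv/=; lra.
Qed.

Section periodic.
Variable f : R -> \bar R.
Hypotheses (mf : measurable_fun setT f) (f0 : forall x, 0 <= f x).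
Hypothesis fper : forall x, f (x + 1)%R = f x.

Lemma periodic_int (n : int) x : f (x + n%:~R)%R = f x.
Proof.
have nat_per (m : nat) y : f (y + m%:R)%R = f y.
  elim: m y => [|m IH] y; first by rewrite addr0.
  by rewrite -[m.+1%:R]natr1 addrA fper IH.
case: n => n; first exact: nat_per.
by rewrite NegzE mulrNz -(nat_per n.+1) -addrA addNr addr0.
Qed.

Lemma integ_shift_int (n : int) a b :
  integ f (a + n%:~R)%R (b + n%:~R)%R = integ f a b.
Proof. by rewrite -integ_shift//; apply: eq_integral => x _; rewrite periodic_int. Qed.

Lemma integ_period a b : integ f a (a + 1)%R = integ f b (b + 1)%R.
Proof.
suff H c : integ f c (c + 1)%R = integ f 0%R 1%R by rewrite !H.
(* Removing the integer part brings c to some e in [0, 1). Then [e, e + 1] splits at 1, and its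
   second piece is the translate of [0, e]. *)
rewrite -(integ_shift_int (- Num.floor c)) mulrNz addrAC; set e := (c - _)%R.
have /andP[e0 e1] : (0 <= e < 1)%R.
  by have := floor_itv c; rewrite intrD /e; lra.
rewrite (@integ_cat f e 1)//; [|exact: ltW|by rewrite lerDr].
rewrite (@integ_cat f 0%R e 1%R)//; last exact: ltW.
by rewrite addeC; congr (_ + _); rewrite -(integ_shift_int 1 0%R e) add0r.
Qed.

Lemma integ_le_period a b c : (b <= a + 1)%R -> integ f a b <= integ f c (c + 1)%R.
Proof. by move=> ab; rewrite -(integ_period a) integ_sub. Qed.

End periodic.
End Translation.

(** * Doubling, and covers of arcs by dyadic intervals *)

Section Doubling.
Context {R : realType}.

Lemma exists_dyadic_scale (l : R) : (0 < l)%R -> (l <= 1)%R ->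
  exists k : nat, (l <= 2 ^- k)%R /\ (2 ^- k < 2 * l)%R.
Proof.
move=> l0 l1.
have exP : exists n : nat, (2 ^- n < l)%R.
  have := @cvg_geometric R 1 2^-1.
  have h : (`|2^-1 : R| < 1)%R by rewrite ger0_norm; lra.
  move=> /(_ h) /cvgrPdist_lt /(_ _ l0) [N _ /(_ N (leqnn N))] /=.
  rewrite sub0r normrN mul1r ger0_norm ?exprn_ge0//.
  by rewrite exprVn => ?; exists N.
(* The scale is one less than the least n with 2^-n < l; that n is positive because l <= 1. *)
case: (ex_minnP exP) => -[|k]; first by rewrite expr0 invr1; lra.
move=> hk /(_ k) hmin; exists k; split.
  by rewrite leNgt; apply/negP => /hmin; rewrite ltnn.
by move: hk; rewrite exprS invfM; lra.
Qed.

(** Since l <= d, an arc that starts in the j-th interval of length d ends no later than the next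
    interval does. *)
Lemma exists_dyadic_cover (a l : R) : (0 < l)%R -> (l <= 1)%R ->
  exists (k : nat) (j : int), let d := (2 ^- k : R)%R in
  [/\ (l <= d)%R, (d < 2 * l)%R, (j%:~R * d <= a)%R,
      (a < (j + 1)%:~R * d)%R & (a + l <= (j + 2)%:~R * d)%R].
Proof.
move=> l0 l1; have [k [ld dl]] := exists_dyadic_scale l0 l1.
exists k, (Num.floor (a * 2 ^+ k)) => d; rewrite -/d in ld dl.
have d0 : (0 < d)%R by lra.
have ad : (a = a * 2 ^+ k * d)%R by rewrite /d mulfK// expf_neq0.
have /andP[h1 h2] := floor_itv (a * 2 ^+ k : R)%R.
have h1' : ((Num.floor (a * 2 ^+ k))%:~R * d <= a)%R.
  by rewrite [leRHS]ad ler_pM2r.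
have h2' : (a < (Num.floor (a * 2 ^+ k) + 1)%:~R * d)%R.
  by rewrite [ltLHS]ad ltr_pM2r.
split => //; move: h2'; rewrite !intrD !mulrDl; lra.
Qed.

Section doubling_weight.
Variables (C : R) (U : R -> \bar R).
Hypotheses (mU : measurable_fun setT U) (U0 : forall x, 0 <= U x).
Hypothesis Uper : forall x, U (x + 1)%R = U x.
Hypothesis dblU : doubling C U.

(** The arc about c is doubled until it contains [a, b] or fills the circle; in the second case
    [b <= a + 1] makes one period dominate the integral. Taking [Num.max 1 C] in place of C keeps an
    early stop below the n-th power. *)
Lemma doubling_iter n (c l a b : R) : (0 < l)%R -> (l <= 1)%R ->
  (b <= a + 1)%R -> (c - 2 ^+ n * l / 2 <= a)%R -> (b <= c + 2 ^+ n * l / 2)%R ->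
  integ U a b <= (Num.max 1 C ^+ n)%:E * integ U (c - l / 2)%R (c + l / 2)%R.
Proof.
set M := Num.max 1%R C.
have M1 : (1 <= M)%R by rewrite /M le_max lexx.
have CM : (C <= M)%R by rewrite /M le_max lexx orbT.
elim: n l => [|n IH] l l0 l1 ba ca cb.
  by rewrite expr0 mul1e; apply: integ_sub => //; lra.
have := dblU (c - l / 2)%R l0 l1; rewrite /= subrK.
rewrite (_ : c - l / 2 + l = c + l / 2)%R; last lra.
set I := integ U (c - l / 2)%R _ => H.
have I0 : 0 <= I by exact: integ_ge0.
have {}H : integ U (c - Num.min l 2^-1)%R (c + Num.min l 2^-1)%R <= M%:E * I.
  by apply: le_trans H _; apply: lee_wpmul2r.
have [l2|l2] := leP l 2^-1%R; last first.
  rewrite min_r in H; last exact: ltW.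
  apply: (@le_trans _ _ (M%:E * I)).
    apply: le_trans H.
    rewrite (_ : c + 2^-1 = c - 2^-1 + 1)%R; last lra.
    exact: integ_le_period.
  by apply: lee_wpmul2r => //; rewrite lee_fin exprS ler_peMr ?exprn_ege1//; lra.
rewrite min_l// in H.
have := IH (2 * l)%R; rewrite (_ : 2 * l / 2 = l)%R; last lra.
move=> IHl; apply: (le_trans (IHl _ _ ba _ _)).
- by lra.
- by lra.
- by move: ca; rewrite exprS; lra.
- by move: cb; rewrite exprS; lra.
rewrite exprSr EFinM -muleA; apply: lee_wpmul2l => //.
by rewrite lee_fin exprn_ge0; lra.
Qed.

Lemma avg_ge0 (f : R -> \bar R) a b : (forall x, 0 <= f x) -> (a <= b)%R ->
  0 <= avg f a b.
Proof.
by move=> f0 ab; rewrite mule_ge0// ?integ_ge0// lee_fin invr_ge0 subr_ge0.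
Qed.

(** The hypotheses speak of dyadic intervals inside [0, 1] only. Euclidean division of j by 2^k
    yields the index there and the integer translation. *)
Lemma dyadic_rep (k : nat) (j : int) : exists (i : nat) (q : int),
  [/\ (i < 2 ^ k)%N, (j%:~R * 2 ^- k = dyl k i + q%:~R :> R)%R &
     ((j + 1)%:~R * 2 ^- k = dyr k i + q%:~R :> R)%R].
Proof.
have k0 : (2 ^ k)%:Z != 0%R by rewrite -lt0n expn_gt0.
have := divz_eq j (2 ^ k)%:Z; have := modz_ge0 j k0.
have : ((j %% (2 ^ k)%:Z)%Z < (2 ^ k)%:Z)%R by rewrite ltz_pmod// ltz_nat expn_gt0.
case: (modz j _) => // i ik _ ->; exists i, (divz j (2 ^ k)%:Z).
have e (x y : R) : ((x * 2 ^+ k + y) * 2 ^- k = y / 2 ^+ k + x)%R.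
  by rewrite mulrDl mulfK ?expf_neq0// addrC.
split => //.
- by rewrite intrD intrM -[X in (_ * X + _)%R]/((2 ^ k)%:R : R)%R natrX e.
- rewrite -addrA intrD intrM -[X in (_ * X + _)%R]/((2 ^ k)%:R : R)%R natrX e /dyr intrD -[i.+1%:R]natr1; exact: erefl.
Qed.

Lemma dyrB k i : (dyr k i - dyl k i = 2 ^- k :> R)%R.
Proof. by rewrite /dyr /dyl -mulrBl -[i.+1%:R]natr1 addrAC subrr add0r mul1r. Qed.

(** Two adjacent intervals of length d < 2l covering an arc of length l reach less than 7l/2 from
    its midpoint, so three doublings, of radius 4l, contain them. The factor 2 bounds d / l when
    integrals become averages. *)
Definition dyadic_cst : R := (2 * Num.max 1 C ^+ 3)%R.

Lemma dyadic_cst_ge1 : (1 <= dyadic_cst)%R.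
Proof.
have : (1 <= Num.max 1 C ^+ 3 :> R)%R by rewrite exprn_ege1// le_max lexx.
by rewrite /dyadic_cst; lra.
Qed.

(** The bound on g is asked only on dyadic intervals whose U-average is comparable to that of the
    arc; this is what allows g to involve a normalisation by the average over the arc. The 4 is two
    intervals times the length ratio d / l < 2. *)
Lemma avg_arc_dyadic (a l : R) (g : R -> \bar R) (K : R) :
  (0 < l)%R -> (l <= 1)%R ->
  measurable_fun setT g -> (forall x, 0 <= g x) ->
  (forall x, g (x + 1)%R = g x) ->
  (forall k j, (j < 2 ^ k)%N ->
    avg U (dyl k j) (dyr k j) <= dyadic_cst%:E * avg U a (a + l)%R ->
    avg U a (a + l)%R <= dyadic_cst%:E * avg U (dyl k j) (dyr k j) ->
    avg g (dyl k j) (dyr k j) <= K%:E) ->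
  avg g a (a + l)%R <= (4 * K)%:E.
Proof.
move=> l0 l1 mg g0 gper H.
have [k [j /= []]] := exists_dyadic_cover a l0 l1.
set d := (2 ^- k)%R => ld dl ja aj alj.
have d0 : (0 < d)%R by lra.
have d1 : (d <= 1)%R by rewrite /d invf_le1 ?exprn_gt0// exprn_ege1//; lra.
have M0 : (0 <= Num.max 1 C ^+ 3 :> R)%R by rewrite exprn_ge0// le_max ler01.
have step (j' : int) : j' = j \/ j' = (j + 1)%R ->
    integ g (j'%:~R * d)%R ((j' + 1)%:~R * d)%R <= (d * K)%:E.
  move=> jj'.
  have [i [q [ik e1 e2]]] := dyadic_rep k j'.
  have := H k i ik; rewrite /avg !dyrB -/d (addrC a l) addrK (addrC l a) e1 e2.
  rewrite (integ_shift_int mg g0 gper).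
  rewrite -(integ_shift_int mU U0 Uper q (dyl k i) (dyr k i)) -e1 -e2 -/d.
  set IU := integ U _ _; set QU := integ U a _.
  have IU0 : 0 <= IU by exact: integ_ge0.
  have QU0 : 0 <= QU by exact: integ_ge0.
  have IQ : IU <= (Num.max 1 C ^+ 3)%:E * QU.
    have := @doubling_iter 3 (a + l / 2)%R l (j'%:~R * d)%R ((j' + 1)%:~R * d)%R l0 l1.
    rewrite (_ : a + l / 2 - l / 2 = a)%R; last lra.
    rewrite (_ : a + l / 2 + l / 2 = a + l)%R; last lra.
    by apply; move: ja aj alj; case: jj' => jj'; rewrite ?jj' ?intrD ?mulrDl; lra.
  have QI : QU <= (Num.max 1 C ^+ 3)%:E * IU.
    have := @doubling_iter 3 (j'%:~R * d + d / 2)%R d a (a + l)%R d0 d1.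
    rewrite (_ : j'%:~R * d + d / 2 - d / 2 = j'%:~R * d)%R; last lra.
    rewrite (_ : j'%:~R * d + d / 2 + d / 2 = (j' + 1)%:~R * d)%R; last by rewrite intrD mulrDl; lra.
    by apply; move: ja aj alj; case: jj' => jj'; rewrite ?jj' ?intrD ?mulrDl; lra.
  have h1 : (d^-1)%:E * IU <= dyadic_cst%:E * ((l^-1)%:E * QU).
    rewrite muleA -EFinM.
    apply: (@le_trans _ _ ((d^-1)%:E * ((Num.max 1 C ^+ 3)%:E * QU))).
      by apply: lee_wpmul2l => //; rewrite lee_fin invr_ge0 ltW.
    rewrite muleA -EFinM; apply: lee_wpmul2r => //; rewrite lee_fin mulrC.
    apply: ler_pM => //; rewrite ?invr_ge0 ?(ltW d0)//; last by rewrite lef_pV2.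
    by rewrite /dyadic_cst; lra.
  have h2 : (l^-1)%:E * QU <= dyadic_cst%:E * ((d^-1)%:E * IU).
    rewrite muleA -EFinM.
    apply: (@le_trans _ _ ((l^-1)%:E * ((Num.max 1 C ^+ 3)%:E * IU))).
      by apply: lee_wpmul2l => //; rewrite lee_fin invr_ge0 ltW.
    rewrite muleA -EFinM; apply: lee_wpmul2r => //; rewrite lee_fin /dyadic_cst.
    rewrite [leRHS]mulrAC ler_wpM2r//.
    by rewrite ler_pdivlMr// mulrC ler_pdivrMr// ltW.
  move=> /(_ h1 h2) h3.
  by move: h3; rewrite muleC lee_pdivrMr// mulrC.
rewrite /avg (addrC a l) addrK (addrC l a) muleC lee_pdivrMr//.
apply: (@le_trans _ _ (integ g (j%:~R * d)%R ((j + 2)%:~R * d)%R)).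
  exact: integ_sub.
rewrite (@integ_cat _ g _ ((j + 1)%:~R * d)%R)//; last 2 first.
- by rewrite ler_pM2r// ler_int lerDl.
- by rewrite ler_pM2r// ler_int lerD2l.
apply: (@le_trans _ _ ((d * K)%:E + (d * K)%:E)).
  apply: leeD; first by apply: step; left.
  by rewrite (_ : j + 2 = j + 1 + 1)%R ?step//; [right|rewrite -addrA].
have K0 : (0 <= d * K)%R.
  by rewrite -lee_fin; apply: le_trans (step j (or_introl erefl)); exact: integ_ge0.
rewrite -EFinD lee_fin; move: K0; rewrite pmulr_rge0// => K0.
have : (d * K <= 2 * l * K)%R by rewrite ler_wpM2r// ltW.
by lra.
Qed.

End doubling_weight.
End Doubling.

(** * Tonelli's theorem on rectangles, by extension by zero *)

Section Tonelli.
Context {R : realType}.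
Local Notation mu := (@lebesgue_measure R).
Variable f : R * R -> \bar R.
Hypotheses (mf : measurable_fun setT f) (f0 : forall z, 0 <= f z).

Lemma measurable_integral1 (A : set R) : measurable A ->
  measurable_fun setT (fun x => \int[mu]_(t in A) f (t, x)).
Proof.
move=> mA.
have mfA : measurable_fun setT (f \_ (A `*` setT)).
  apply/(measurable_restrictT _ _).1 => //; first exact: measurableX.
  exact: measurable_funTS.
have := @measurable_fun_fubini_tonelli_G _ _ (measurableTypeR R) (measurableTypeR R) R mu
  (f \_ (A `*` setT)) mfA.
move=> H; apply: eq_measurable_fun (H _) => [x _|z]; last exact: erestrict_ge0.
rewrite /fubini_G [RHS]integral_mkcond; apply: eq_integral => t _ /=.
by rewrite !patchE in_setX in_setT andbT.
Qed.

Lemma measurable_integral2 (B : set R) : measurable B ->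
  measurable_fun setT (fun t => \int[mu]_(x in B) f (t, x)).
Proof.
move=> mB.
have mfB : measurable_fun setT (f \_ (setT `*` B)).
  apply/(measurable_restrictT _ _).1 => //; first exact: measurableX.
  exact: measurable_funTS.
have := @measurable_fun_fubini_tonelli_F _ _ (measurableTypeR R) (measurableTypeR R) R mu
  (f \_ (setT `*` B)) mfB.
move=> H; apply: eq_measurable_fun (H _) => [x _|z]; last exact: erestrict_ge0.
rewrite /fubini_F [RHS]integral_mkcond; apply: eq_integral => t _ /=.
by rewrite !patchE in_setX in_setT.
Qed.

Lemma tonelli_in (A B : set R) : measurable A -> measurable B ->
  \int[mu]_(t in A) \int[mu]_(x in B) f (t, x) =
  \int[mu]_(x in B) \int[mu]_(t in A) f (t, x).
Proof.
move=> mA mB.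
have mfAB : measurable_fun setT (f \_ (A `*` B)).
  apply/(measurable_restrictT _ _).1 => //; first exact: measurableX.
  exact: measurable_funTS.
have := @fubini_tonelli _ _ (measurableTypeR R) (measurableTypeR R) R mu mu
  (f \_ (A `*` B)) mfAB.
move=> /(_ _)/= H; rewrite integral_mkcond [RHS]integral_mkcond.
transitivity (\int[mu]_t \int[mu]_x (f \_ (A `*` B)) (t, x)); last rewrite H.
- apply: eq_integral => t _; rewrite patchE; case: ifPn => tA.
    rewrite integral_mkcond; apply: eq_integral => x _.
    by rewrite !patchE in_setX tA.
  by rewrite integral0_eq// => x _; rewrite patchE in_setX (negbTE tA).
- apply: eq_integral => x _; rewrite [RHS]patchE; case: ifPn => xB.
    rewrite [RHS]integral_mkcond; apply: eq_integral => t _.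
    by rewrite !patchE in_setX xB andbT.
  by rewrite integral0_eq// => t _; rewrite patchE in_setX (negbTE xB) andbF.
- by move=> z; exact: erestrict_ge0.
Qed.

End Tonelli.

(** * Jensen's inequality with a normalisation that varies with t *)

Section Jensen.
Context {R : realType}.
Local Notation mu := (@lebesgue_measure R).

(* phi is the supremum of its affine minorants; stated with strict inequalities
   so that it also covers points where phi is +oo. *)
Definition affine_sup (phi : R -> \bar R) : Prop :=
  forall y0 z : R, (0 <= y0)%R -> z%:E < phi y0 ->
  exists a b : R, (forall y, (0 <= y)%R -> (a * y + b)%:E <= phi y) /\
                  (z < a * y0 + b)%R.

Lemma ae_impl (P P' : R -> Prop) : (forall x, P x -> P' x) ->
  {ae mu, forall x, P x} -> {ae mu, forall x, P' x}.
Proof. by move=> h; apply: filterS => //; exact: (ae_filter_ringOfSetsType mu). Qed.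

Lemma ge0_integrable d (T : measurableType d) (nu : {measure set T -> \bar R})
    (D : set T) (f : T -> \bar R) :
  measurable D -> measurable_fun D f -> (forall x, D x -> 0 <= f x) ->
  \int[nu]_(x in D) f x < +oo -> nu.-integrable D f.
Proof.
move=> mD mf f0 foo; apply/integrableP; split => //.
by under eq_integral => x /[!inE] Dx do rewrite gee0_abs ?f0//.
Qed.

Lemma measurable_inv_pos d (T : measurableType d) (m : T -> R) :
  measurable_fun setT m -> (forall t, 0 < m t)%R ->
  measurable_fun setT (fun t => (m t)^-1)%R.
Proof.
move=> mm m0; apply: (eq_measurable_fun (fun t => m t `^ (-1))%R).
  by move=> t _; rewrite powR_inv1// ltW.
exact: (measurableT_comp (measurable_powR (-1)%R) mm).
Qed.

Variable phi : R -> \bar R.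
Hypotheses (mphi : measurable_fun setT phi)
  (phi0 : forall y, (0 <= y)%R -> 0 <= phi y) (phic : affine_sup phi).
Variables (G : R * R -> R) (m : R -> R).
Hypotheses (mG : measurable_fun setT G) (G0 : forall z, (0 <= G z)%R).
Hypotheses (mm : measurable_fun setT m) (m0 : forall t, (0 < m t)%R).
Variables (A Q : set R) (M : R).
Hypotheses (mA : measurable A) (mQ : measurable Q).
Hypothesis (M0 : (0 < M)%R).
Hypothesis mM : \int[mu]_(t in A) (m t)%:E = M%:E.

(** The perspective of phi. For an affine phi(y) = a y + b it equals a G + b m, so the denominator
    disappears before integration in t. *)
Let F (z : R * R) : \bar R := (m z.1)%:E * phi (G z / m z.1)%R.
Let om (x : R) : \bar R := \int[mu]_(t in A) (G (t, x))%:E.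

Let y0 z : (0 <= G z / m z.1)%R.
Proof. by rewrite divr_ge0// ltW. Qed.

Let F0 z : 0 <= F z.
Proof. by rewrite mule_ge0 ?phi0// lee_fin ltW. Qed.

Let mquot : measurable_fun setT (fun z : R * R => (G z / m z.1)%R).
Proof.
apply: measurable_funM => //.
by apply: measurable_inv_pos => //; exact: measurableT_comp.
Qed.

Let mF : measurable_fun setT F.
Proof.
apply: emeasurable_funM; last exact: measurableT_comp.
by apply/measurable_EFinP; exact: measurableT_comp.
Qed.

Let mEG : measurable_fun setT (EFin \o G).
Proof. exact/measurable_EFinP. Qed.

Let EG0 z : 0 <= (EFin \o G) z.
Proof. by rewrite lee_fin. Qed.

(* The perspective form of Jensen's inequality, tested on affine minorants. *)
Lemma jensen_pointwise (x : R) : om x \is a fin_num ->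
  M%:E * phi (fine (om x) / M)%R <= \int[mu]_(t in A) F (t, x).
Proof.
move=> omx; rewrite leNgt; apply/negP => lt.
have int0 : 0 <= \int[mu]_(t in A) F (t, x) by exact: integral_ge0.
have intfin : \int[mu]_(t in A) F (t, x) \is a fin_num.
  by rewrite ge0_fin_numE//; apply: lt_le_trans lt _; rewrite leey.
have om0 : (0 <= fine (om x))%R by rewrite fine_ge0//; apply: integral_ge0 => t _; rewrite lee_fin.
have yx0 : (0 <= fine (om x) / M)%R by rewrite divr_ge0// ltW.
(* If the inequality fails, the integral of F divided by M is a real number strictly below phi at om
   / M. Some affine minorant exceeds it there, and integrating that minorant in t contradicts
   this. *)
move: lt; rewrite -(fineK intfin) -lte_pdivrMl// -EFinM => lt.
have [a [b [minor]]] := phic yx0 lt.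
have mFx : measurable_fun A (fun t => F (t, x)).
  by apply: measurable_funTS; exact: measurable_fun_pair1.
have iF : mu.-integrable A (fun t => F (t, x)).
  by apply: ge0_integrable => //; rewrite -ge0_fin_numE.
have iG : mu.-integrable A (fun t => (G (t, x))%:E).
  apply: ge0_integrable => //.
  - by apply: measurable_funTS; exact: (measurable_fun_pair1 _ mEG).
  - by move=> t _; rewrite lee_fin.
  - by rewrite -ge0_fin_numE//; apply: integral_ge0 => t _; rewrite lee_fin.
have im : mu.-integrable A (fun t => (m t)%:E).
  apply: ge0_integrable => //.
  - by apply: measurable_funTS; apply/measurable_EFinP.
  - by move=> t _; rewrite lee_fin ltW.
  - by rewrite mM ltry.
have iaG : mu.-integrable A (fun t => a%:E * (G (t, x))%:E) by exact: integrableZl.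
have ibm : mu.-integrable A (fun t => b%:E * (m t)%:E) by exact: integrableZl.
have : \int[mu]_(t in A) (a%:E * (G (t, x))%:E + b%:E * (m t)%:E)
    <= \int[mu]_(t in A) F (t, x).
  apply: le_integral => //; first exact: integrableD.
  move=> t _; have := minor _ (y0 (t, x)) => /=.
  rewrite -(@lee_pmul2l _ (m t)%:E)//; last by rewrite lte_fin.
  move=> /(le_trans _); apply.
  rewrite -!EFinM -EFinD lee_fin.
  have mt0 : m t != 0%R by rewrite gt_eqF.
  by rewrite le_eqVlt; apply/orP; left; apply/eqP; field.
rewrite integralD// !integralZl// mM -/(om x) -(fineK omx) -(fineK intfin).
rewrite -!EFinM -EFinD lee_fin => h1 h2.
have : (M * (M^-1 * fine (\int[mu]_(t in A) F (t, x))) <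
        M * (a * (fine (om x) / M) + b))%R by rewrite ltr_pM2l.
have Mn0 : M != 0%R by rewrite gt_eqF.
rewrite mulVKf//.
rewrite (_ : M * (a * (fine (om x) / M) + b) = a * fine (om x) + b * M)%R; last by field.
by rewrite ltNge h1.
Qed.

(** The pointwise inequality is available where [om] is finite, hence almost everywhere on Q. After
    Tonelli the uniform bound K is integrated against m, of total mass M, and M cancels. *)
Lemma jensen_integral (K : R) :
  \int[mu]_(x in Q) om x < +oo ->
  (forall t, A t -> \int[mu]_(x in Q) phi (G (t, x) / m t)%R <= K%:E) ->
  \int[mu]_(x in Q) phi (fine (om x) / M)%R <= K%:E.
Proof.
move=> omoo HK.
have mom : measurable_fun setT om by exact: (measurable_integral1 mEG EG0 mA).
have om0 x : 0 <= om x by apply: integral_ge0 => t _; rewrite lee_fin.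
have iom : mu.-integrable Q om.
  by apply: ge0_integrable => //; exact: measurable_funTS.
have mphiom : measurable_fun setT (fun x => phi (fine (om x) / M)%R).
  apply: (measurableT_comp mphi); apply: measurable_funM => //.
  exact: (measurableT_comp (fine_measurable measurableT)).
have phiom0 x : 0 <= phi (fine (om x) / M)%R.
  by apply: phi0; rewrite divr_ge0 ?fine_ge0// ltW.
have mFi : measurable_fun setT (fun x => \int[mu]_(t in A) F (t, x)).
  exact: (measurable_integral1 mF F0 mA).
rewrite -(@lee_pmul2l _ M%:E)//.
rewrite -ge0_integralZl_EFin//; last 2 first.
  exact: measurable_funTS.
  exact: ltW.
apply: (@le_trans _ _ (\int[mu]_(x in Q) \int[mu]_(t in A) F (t, x))).
  apply: ae_ge0_le_integral => //.
  - by move=> x _; rewrite mule_ge0// lee_fin ltW.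
  - by apply: measurable_funTS; exact: measurable_funeM.
  - by move=> x _; exact: integral_ge0.
  - exact: measurable_funTS.
  - have : {ae mu, forall x, Q x -> om x \is a fin_num} by exact: integrable_ae.
    by apply: ae_impl => x h Qx; exact/jensen_pointwise/h.
rewrite -(tonelli_in mF F0)//.
apply: (@le_trans _ _ (\int[mu]_(t in A) (K%:E * (m t)%:E))); last first.
  rewrite integralZl// ?mM 1?muleC//.
  apply: ge0_integrable => //.
  - by apply: measurable_funTS; apply/measurable_EFinP.
  - by move=> t _; rewrite lee_fin ltW.
  - by rewrite mM ltry.
apply: ge0_le_integral => //.
- by move=> t _; exact: integral_ge0.
- by apply: measurable_funTS; exact: (measurable_integral2 mF F0 mQ).
- by apply: measurable_funTS; apply: measurable_funeM; apply/measurable_EFinP.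
- move=> t At; rewrite /F /= ge0_integralZl_EFin//.
  + by rewrite muleC lee_pmul2r ?HK// lte_fin.
  + by move=> x _; apply: phi0; exact: (y0 (t, x)).
  + apply: measurable_funTS; apply: (measurableT_comp mphi).
    exact: (measurable_fun_pair2 _ mquot).
  + exact: ltW.
Qed.

End Jensen.

(** * The convex test functions and their affine minorants *)

Section TestFunctions.
Context {R : realType}.

Lemma affine_sup_tangent (phi : R -> \bar R) (y0 z : R) :
  (exists a b : R, (forall y, (0 <= y)%R -> (a * y + b)%:E <= phi y) /\
                   phi y0 <= (a * y0 + b)%:E) ->
  z%:E < phi y0 ->
  exists a b : R, (forall y, (0 <= y)%R -> (a * y + b)%:E <= phi y) /\
                  (z < a * y0 + b)%R.
Proof.
move=> [a [b [minor h]]] lt; exists a, b; split => //.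
by rewrite -lte_fin; exact: lt_le_trans lt h.
Qed.

Lemma ln_le_sub1 (x : R) : (0 < x)%R -> (ln x <= x - 1)%R.
Proof.
move=> x0; rewrite -[in leRHS](lnK (x := x)) ?posrE//.
by have := expR_ge1Dx (ln x); lra.
Qed.

Lemma tangent_ln (x y : R) : (0 < x)%R -> (0 < y)%R -> (ln y <= ln x + (y / x - 1))%R.
Proof.
move=> x0 y0; have := ln_le_sub1 (divr_gt0 y0 x0).
by rewrite ln_div ?posrE//; lra.
Qed.

(** By homogeneity it suffices to treat the tangent at 1, where t^(-s) = exp(- s ln t) >= 1 - s ln t
    >= 1 - s (t - 1). *)
Lemma tangent_powRN (s x y : R) : (0 < s)%R -> (0 < x)%R -> (0 < y)%R ->
  (x `^ (- s) - s * x `^ (- s) * (y / x - 1) <= y `^ (- s))%R.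
Proof.
move=> s0 x0 y0.
have -> : (y `^ (- s) = x `^ (- s) * (y / x) `^ (- s))%R.
  by rewrite -powRM ?(ltW x0) ?divr_ge0 ?ltW// mulrC divfK// gt_eqF.
have : (1 - s * (y / x - 1) <= (y / x) `^ (- s))%R.
  rewrite /powR gt_eqF ?divr_gt0//.
  apply: le_trans (expR_ge1Dx _).
  have : (s * ln (y / x) <= s * (y / x - 1))%R.
    by rewrite ler_pM2l// ln_le_sub1// divr_gt0.
  by lra.
move=> /(ler_wpM2l (powR_ge0 x (- s))).
by lra.
Qed.

Definition phi_neg (s y : R) : \bar R := negpow s y%:E.

Lemma phi_neg_ge0 s y : 0 <= phi_neg s y.
Proof. by rewrite /phi_neg /=; case: ifP => // _; rewrite lee_fin powR_ge0. Qed.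

Lemma measurable_phi_neg s : measurable_fun setT (phi_neg s).
Proof.
apply: measurable_fun_ifT => //.
  by apply: measurable_fun_eqr.
by apply/measurable_EFinP; exact: measurable_powR.
Qed.

Lemma affine_sup_phi_neg s : (0 < s)%R -> affine_sup (phi_neg s).
Proof.
move=> s0 y z y_ge0.
have minor (x : R) : (0 < x)%R -> forall y, (0 <= y)%R ->
    (- (s * x `^ (- s) / x) * y + (1 + s) * x `^ (- s))%:E <= phi_neg s y.
  move=> x0 t t0; rewrite /phi_neg /=.
  case: ifPn => [_|tn0]; first exact: leey.
  have tp : (0 < t)%R by rewrite lt_neqAle eq_sym tn0.
  by rewrite lee_fin; apply: le_trans (tangent_powRN s0 x0 tp); lra.
have [-> _|yn0] := eqVneq y 0%R.
  (* At 0 the value is +oo, so no tangent exists. The tangent at x has intercept (1 + s) x^(-s), and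
     this x makes x^(-s) equal to |z| + 1. *)
  have x0 : (0 < (`|z| + 1) `^ (- s^-1))%R.
    by rewrite powR_gt0// ltr_wpDl.
  exists (- (s * ((`|z| + 1) `^ (- s^-1)) `^ (- s) / ((`|z| + 1) `^ (- s^-1))))%R.
  exists ((1 + s) * ((`|z| + 1) `^ (- s^-1)) `^ (- s))%R; split; first exact: minor.
  rewrite mulr0 add0r -powRrM mulrNN mulVf ?gt_eqF// powRr1 ?addr_ge0//.
  have := ler_norm z; have := normr_ge0 z => h1 h2.
  have : (0 <= s * (`|z| + 1))%R by rewrite mulr_ge0; lra.
  by lra.
have y0 : (0 < y)%R by rewrite lt_neqAle eq_sym yn0.
apply: affine_sup_tangent; eexists; eexists; split; first exact: (minor y).
rewrite /phi_neg /= (negbTE yn0) lee_fin mulNr divfK//.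
by lra.
Qed.

(* The affine term y - 1 has average 0 after normalisation; it makes - ln y
   nonnegative. *)
Definition phi_log (y : R) : \bar R := if y == 0%R then +oo else (y - 1 - ln y)%:E.

Lemma phi_log_ge0 y : (0 <= y)%R -> 0 <= phi_log y.
Proof.
move=> y0; rewrite /phi_log; case: ifPn => // yn0.
have yp : (0 < y)%R by rewrite lt_neqAle eq_sym yn0.
by rewrite lee_fin subr_ge0 ln_le_sub1.
Qed.

Lemma measurable_phi_log : measurable_fun setT phi_log.
Proof.
apply: measurable_fun_ifT => //.
  by apply: measurable_fun_eqr.
apply/measurable_EFinP; apply: measurable_funB; last exact: measurable_ln.
exact: measurable_funB.
Qed.

Lemma affine_sup_phi_log : affine_sup phi_log.
Proof.
move=> y z y_ge0.
have minor (x : R) : (0 < x)%R -> forall y, (0 <= y)%R ->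
    ((1 - x^-1) * y - ln x)%:E <= phi_log y.
  move=> x0 t t0; rewrite /phi_log /=.
  case: ifPn => [_|tn0]; first exact: leey.
  have tp : (0 < t)%R by rewrite lt_neqAle eq_sym tn0.
  by rewrite lee_fin; have := tangent_ln x0 tp; lra.
have [-> _|yn0] := eqVneq y 0%R.
  (* The tangent at x has intercept - ln x, which is |z| + 1 for this x. *)
  exists (1 - (expR (- (`|z| + 1)))^-1)%R, (- ln (expR (- (`|z| + 1))))%R.
  split; first by apply: minor; exact: expR_gt0.
  by rewrite expRK mulr0; have := ler_norm z; lra.
have y0 : (0 < y)%R by rewrite lt_neqAle eq_sym yn0.
apply: affine_sup_tangent; eexists; eexists; split; first exact: (minor y).
by rewrite /phi_log (negbTE yn0) lee_fin mulrBl mul1r mulVf.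
Qed.

(** The tangent inequality is Young's inequality for y and x^(p-1) with exponents p and p / (p -
    1). *)
Lemma affine_sup_powR (p : R) : (1 < p)%R -> affine_sup (fun y => (y `^ p)%:E).
Proof.
move=> p1 x z x0; apply: affine_sup_tangent.
have p0 : (0 < p)%R by lra.
have q0 : (0 < p / (p - 1))%R by rewrite divr_gt0//; lra.
have pn0 : p != 0%R by rewrite gt_eqF.
have p1n0 : (p - 1)%R != 0%R by rewrite gt_eqF// subr_gt0.
exists (p * x `^ (p - 1))%R, ((1 - p) * x `^ p)%R; split => [y y0|]; last first.
  by rewrite lee_fin -mulrA [(_ `^ _ * x)%R]mulrC mulr_powRB1//; lra.
rewrite lee_fin.
have pq : (p^-1 + (p / (p - 1))^-1 = 1)%R by field; rewrite pn0 p1n0.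
have := conjugate_powR y0 (powR_ge0 x (p - 1)) p0 q0 pq.
rewrite -powRrM mulrCA mulfV// mulr1 => h.
have := ler_wpM2l (ltW p0) h.
rewrite (_ : p * (y `^ p / p + x `^ p / (p / (p - 1))) = y `^ p + (p - 1) * x `^ p)%R; last first.
  by field; rewrite pn0 p1n0.
by lra.
Qed.

Lemma affine_sup_max (a b : R) : affine_sup (fun y => (Num.max (a * y + b) 0)%:E).
Proof.
move=> x z x0; apply: affine_sup_tangent.
have [h|h] := leP (a * x + b)%R 0%R.
  exists 0%R, 0%R; split => [y _|]; last by rewrite mul0r addr0.
  by rewrite mul0r addr0 lee_fin le_max lexx orbT.
by exists a, b; split => // y _; rewrite lee_fin le_max lexx.
Qed.

Lemma measurable_max_affine (a b : R) :
  measurable_fun setT (fun y : R => (Num.max (a * y + b) 0)%:E).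
Proof.
apply/measurable_EFinP; apply: measurable_maxr => //.
by apply: measurable_funD => //; exact: measurable_funM.
Qed.

Lemma measurable_EFin_powR (p : R) : measurable_fun setT (fun y : R => (y `^ p)%:E).
Proof. by apply/measurable_EFinP; exact: measurable_powR. Qed.

End TestFunctions.

(** * Transfer of a convex bound from the family to its translation-average *)

Section TranslationAverage.
Context {R : realType}.
Local Notation mu := (@lebesgue_measure R).

Lemma ae_eq0_integral_itv (f : R -> \bar R) (a b : R) :
  measurable_fun setT f -> (forall x, 0 <= f x) -> integ f a b = 0 ->
  {ae mu, forall x, x \in `[a, b] -> f x = 0}.
Proof.
move=> mf f0 h; rewrite /integ in h.
have := @ae_eq_integral_abs _ (measurableTypeR R) R mu `[a, b]%classic _ f _.
move=> /(_ _ _)[||h1 _] //; first exact: measurable_funTS.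
have := h1 _; rewrite -[X in (X = _ -> _) -> _](_ : \int[mu]_(x in `[a, b]) f x = _); last first.
  by apply: eq_integral => x _; rewrite gee0_abs.
by move=> /(_ h); exact.
Qed.

Lemma integ_gt0 (f : R -> \bar R) (a b : R) : (a < b)%R ->
  measurable_fun setT f -> (forall x, 0 <= f x) ->
  (forall x, x \in `[a, b] -> 0 < f x) -> 0 < integ f a b.
Proof.
move=> ab mf f0 fp; rewrite lt_neqAle integ_ge0// andbT eq_sym.
apply/eqP => /(ae_eq0_integral_itv mf f0) [N [mN N0 sub]].
have : mu `[a, b]%classic <= mu N.
  rewrite le_measure ?inE//.
  by move=> x xab; apply: sub => /(_ xab) fx0; have := fp _ xab; rewrite fx0 ltxx.
by rewrite N0 lebesgue_measure_itv/= lte_fin ab -EFinB lee_fin leNgt subr_gt0 ab.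
Qed.

Variables (C : R) (w : R -> R -> R).
Hypothesis fam : family_hyp C w.
Local Notation I01 := (`[0%R, 1%R]%classic : set R).
Let U t : R -> \bar R := EFin \o w t.

Section member.
Variable t : R.
Hypothesis t01 : t \in `[0%R, 1%R].

Lemma weight_ge0 x : (0 <= w t x)%R.
Proof. by case: fam => /(_ _ t01)[]. Qed.

Lemma weight_periodic x : w t (x + 1)%R = w t x.
Proof. by case: fam => /(_ _ t01)[]. Qed.

Lemma measurable_weight : measurable_fun setT (w t).
Proof. by case: fam => /(_ _ t01)[]. Qed.

Lemma doubling_weight : doubling C (U t).
Proof. by case: fam => _ /(_ _ t01). Qed.

Lemma measurable_Eweight : measurable_fun setT (U t).
Proof. by apply/measurable_EFinP; exact: measurable_weight. Qed.

Lemma Eweight_ge0 x : 0 <= U t x.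
Proof. by rewrite lee_fin weight_ge0. Qed.

Lemma integ_weight_lty a b : (b <= a + 1)%R -> integ (U t) a b < +oo.
Proof.
move=> ab; apply: (@le_lt_trans _ _ (integ (U t) 0%R (0 + 1)%R)).
  apply: integ_le_period => //; first exact: measurable_Eweight.
    exact: Eweight_ge0.
  by move=> x; rewrite /U /= weight_periodic.
rewrite add0r; case: fam => /(_ _ t01)[_ _ _ +] _ _ _ => /integrable_lty.
by apply.
Qed.

End member.

(** Nothing is known about [w t] for t outside [0, 1]. Extending by zero before the shear x + t
    gives a nonnegative function measurable on the whole plane, as Tonelli and Jensen require. *)
Let G (z : R * R) : R :=
  ((fun z => w z.1 z.2) \_ (I01 `*` setT)) (z.1, z.2 + z.1)%R.

Lemma transl_extE t x : t \in `[0%R, 1%R] -> G (t, x) = w t (x + t)%R.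
Proof. by move=> t01; rewrite /G patchE mem_set. Qed.

Lemma transl_ext_ge0 z : (0 <= G z)%R.
Proof.
rewrite /G patchE; case: ifPn => // /[!inE] -[/= t01 _].
exact: weight_ge0.
Qed.

Lemma measurable_transl_ext : measurable_fun setT G.
Proof.
have mw : measurable_fun setT ((fun z : R * R => w z.1 z.2) \_ (I01 `*` setT)).
  apply/(measurable_restrictT _ _).1; first exact: measurableX.
  by case: fam.
apply: (measurableT_comp mw); apply: measurable_fun_pair => //.
exact: measurable_funD.
Qed.

Let mEG : measurable_fun setT (EFin \o G).
Proof. by apply/measurable_EFinP; exact: measurable_transl_ext. Qed.

Let EG0 z : 0 <= (EFin \o G) z.
Proof. by rewrite lee_fin transl_ext_ge0. Qed.

Lemma transl_avgE x : transl_avg w x = \int[mu]_(t in I01) (G (t, x))%:E.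
Proof. by apply: eq_integral => t /[!inE] t01; rewrite transl_extE. Qed.

Lemma measurable_transl_avg : measurable_fun setT (transl_avg w).
Proof.
apply: eq_measurable_fun (measurable_integral1 mEG EG0 (measurable_itv _)).
by move=> x _; rewrite transl_avgE.
Qed.

Lemma transl_avg_ge0 x : 0 <= transl_avg w x.
Proof. by rewrite transl_avgE; apply: integral_ge0 => t _; exact: EG0. Qed.

Lemma transl_avg_periodic x : transl_avg w (x + 1)%R = transl_avg w x.
Proof.
apply: eq_integral => t /[!inE] t01.
by rewrite addrAC weight_periodic.
Qed.

Lemma integ_transl_avg_lty a b : (b <= a + 1)%R -> integ (transl_avg w) a b < +oo.
Proof.
move=> ab; apply: (@le_lt_trans _ _ (integ (transl_avg w) 0%R (0 + 1)%R)).
  apply: integ_le_period => //.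
  - exact: measurable_transl_avg.
  - exact: transl_avg_ge0.
  - exact: transl_avg_periodic.
by rewrite add0r; case: fam.
Qed.

Lemma integ_transl_avg_fin_num a b : (b <= a + 1)%R ->
  integ (transl_avg w) a b \is a fin_num.
Proof.
move=> ab; rewrite ge0_fin_numE ?integ_transl_avg_lty//.
by apply: integ_ge0; exact: transl_avg_ge0.
Qed.

(** The common core of the five cases. The number m stands for the average of [w t] over the
    translated arc, plus eps; a case has only to bound phi(w / m) on dyadic intervals whose average
    is comparable to m. *)
Lemma avg_phi_transl_avg (phi : R -> \bar R) (K eps a l : R) :
  measurable_fun setT phi -> (forall y, (0 <= y)%R -> 0 <= phi y) ->
  affine_sup phi -> (0 <= eps)%R -> (0 < l)%R -> (l <= 1)%R ->
  (forall t, t \in `[0%R, 1%R] -> forall k j, (j < 2 ^ k)%N ->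
     0 < avg (U t) (dyl k j) (dyr k j) + eps%:E) ->
  (forall t, t \in `[0%R, 1%R] -> forall k j, (j < 2 ^ k)%N ->
     forall m : R, (0 < m)%R ->
     avg (U t) (dyl k j) (dyr k j) <= (dyadic_cst C * m)%:E ->
     m%:E <= (dyadic_cst C)%:E * (avg (U t) (dyl k j) (dyr k j) + eps%:E) ->
     avg (fun x => phi (w t x / m)%R) (dyl k j) (dyr k j) <= K%:E) ->
  exists M : R, [/\ (0 < M)%R, avg (transl_avg w) a (a + l)%R + eps%:E = M%:E &
    avg (fun x => phi (fine (transl_avg w x) / M)%R) a (a + l)%R <= (4 * K)%:E].
Proof.
move=> mphi phi0 phic eps0 l0 l1 pos dyad.
have D1 : (1 <= dyadic_cst C)%R := dyadic_cst_ge1 C.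
pose h t := l^-1%:E * \int[mu]_(x in `[a, (a + l)%R]) (G (t, x))%:E.
have hE t : t \in `[0%R, 1%R] -> h t = avg (U t) (a + t)%R (a + t + l)%R.
  move=> t01; rewrite /h /avg.
  rewrite (_ : a + t + l - (a + t) = l)%R; last lra.
  congr (_ * _); rewrite (addrAC a t l).
  rewrite -(integ_shift _ _ _ (measurable_Eweight t01) (Eweight_ge0 t01)).
  by apply: eq_integral => x _; rewrite transl_extE.
have h0 t : 0 <= h t.
  by rewrite mule_ge0// ?lee_fin ?invr_ge0 ?(ltW l0)//; apply: integral_ge0 => x _; exact: EG0.
have hfin t : t \in `[0%R, 1%R] -> h t \is a fin_num.
  move=> t01; rewrite hE// fin_numM// ge0_fin_numE ?integ_weight_lty//; last first.
    exact: (integ_ge0 _ _ (Eweight_ge0 t01)).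
  by rewrite lerD2l.
have mh : measurable_fun setT h.
  by apply: measurable_funeM; exact: (measurable_integral2 mEG EG0 (measurable_itv _)).
(* The value 1 outside [0, 1] keeps m positive everywhere. *)
pose m t : R := if t \in `[0%R, 1%R] then (fine (h t) + eps)%R else 1%R.
have mE t : t \in `[0%R, 1%R] -> (m t)%:E = h t + eps%:E.
  by move=> t01; rewrite /m t01 EFinD fineK// hfin.
have mm : measurable_fun setT m.
  apply: measurable_fun_ifT => //.
    apply: (measurable_fun_bool true); rewrite setTI.
    rewrite [X in measurable X](_ : _ = I01); first exact: measurable_itv.
    by apply/seteqP; split => x /=.
  apply: measurable_funD => //.
  exact: (measurableT_comp (fine_measurable measurableT)).
have m0 t : (0 < m t)%R.
  rewrite {1}/m; case: ifPn => // t01.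
  rewrite lt_neqAle addr_ge0 ?fine_ge0// andbT eq_sym; apply/eqP => m_eq0.
  have fh0 := fine_ge0 (h0 t).
  have e0 : eps = 0%R by lra.
  have ht0 : h t = 0 by rewrite -(fineK (hfin t t01)); congr (_%:E); lra.
  (* With K = -1 the conclusion is absurd, so some dyadic interval comparable
     to the arc must have average 0. *)
  have : avg (cst 0) (a + t)%R (a + t + l)%R <= (4 * -1)%:E.
    apply: (avg_arc_dyadic (measurable_Eweight t01) (Eweight_ge0 t01) _
      (doubling_weight t01)) => //; first by move=> x; rewrite /U /= weight_periodic.
    rewrite -hE// ht0 mule0 => k j jk Ile0 _.
    by have := pos _ t01 k j jk; rewrite e0 adde0 ltNge Ile0.
  by rewrite /avg /integ integral0 mule0 lee_fin; lra.
pose M : R := (fine (avg (transl_avg w) a (a + l)%R) + eps)%R.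
have afin : avg (transl_avg w) a (a + l)%R \is a fin_num.
  by rewrite fin_numM// integ_transl_avg_fin_num// lerD2l.
have ME : avg (transl_avg w) a (a + l)%R + eps%:E = M%:E by rewrite /M EFinD fineK.
have intm : \int[mu]_(t in I01) (m t)%:E = M%:E.
  rewrite -ME.
  transitivity (\int[mu]_(t in I01) (h t + eps%:E)).
    by apply: eq_integral => t /[!inE] t01; rewrite mE.
  rewrite ge0_integralD//; last exact: measurable_funTS.
  have -> : \int[mu]_(t in I01) eps%:E = eps%:E.
    rewrite -[LHS]/(\int[mu]_(t in I01) cst eps%:E t) integral_cst//=.
    by rewrite lebesgue_measure_itv/= lte_fin ltr01 -EFinB subr0 mule1.
  congr (_ + _).
  rewrite ge0_integralZl_EFin//; last 3 first.
  - by move=> t _; apply: integral_ge0 => x _; exact: EG0.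
  - by apply: measurable_funTS; exact: (measurable_integral2 mEG EG0 (measurable_itv _)).
  - by rewrite invr_ge0 ltW.
  rewrite (tonelli_in mEG EG0)// /avg (addrC a l) addrK (addrC l a).
  by congr (_ * _); apply: eq_integral => x _; rewrite transl_avgE.
have M0 : (0 < M)%R.
  rewrite -lte_fin -intm; apply: integ_gt0 => //.
  - exact/measurable_EFinP.
  - by move=> t; rewrite lee_fin ltW.
  - by move=> t _; rewrite lte_fin.
exists M; split => //.
rewrite /avg (addrC a l) addrK (addrC l a) lee_pdivrMl// -EFinM.
have := @jensen_integral R phi mphi phi0 phic G m measurable_transl_ext transl_ext_ge0
  mm m0 I01 `[a, (a + l)%R]%classic M (measurable_itv _) (measurable_itv _) M0 intm
  (l * (4 * K))%R.
under eq_integral do rewrite -transl_avgE.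
move=> H; rewrite /integ; under eq_integral do rewrite transl_avgE.
apply: H; first by apply: integ_transl_avg_lty; rewrite lerD2l.
move=> t t01; pose g x := phi (w t x / m t)%R.
have mg : measurable_fun setT g.
  apply: (measurableT_comp mphi); apply: measurable_funM => //.
  exact: measurable_weight.
have g0 x : 0 <= g x by apply: phi0; rewrite divr_ge0 ?weight_ge0// ltW.
have gper x : g (x + 1)%R = g x by rewrite /g weight_periodic.
have := avg_arc_dyadic (measurable_Eweight t01) (Eweight_ge0 t01) _ (doubling_weight t01)
     (a := (a + t)%R) l0 l1 mg g0 gper (K := K).
rewrite -hE// => Havg.
have : avg g (a + t)%R (a + t + l)%R <= (4 * K)%:E.
  apply: Havg; first by move=> x; rewrite /U /= weight_periodic.
  (* Adding eps preserves both comparisons with the same constant because [dyadic_cst C] is at least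
     1. *)
  move=> k j jk h1 h2; apply: dyad => //.
  - rewrite EFinM; apply: le_trans h1 _.
    by rewrite mE// lee_pmul2l ?lte_fin ?leeDl ?lee_fin//; lra.
  - rewrite mE// ge0_muleDr ?lee_fin//; last first.
      apply: avg_ge0; first exact: Eweight_ge0.
      by rewrite -subr_ge0 dyrB invr_ge0 exprn_ge0.
    apply: leeD => //; rewrite -EFinM lee_fin ler_peMl//.
rewrite /avg (_ : a + t + l - (a + t) = l)%R; last lra.
rewrite lee_pdivrMl// -EFinM (addrAC a t l) -integ_shift//.
move=> H2; apply: le_trans H2; rewrite le_eqVlt; apply/orP; left; apply/eqP.
by apply: eq_integral => x _; rewrite transl_extE.
Qed.

End TranslationAverage.

(** * Averages over an interval, up to null sets *)

Section Averages.
Context {R : realType}.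
Local Notation mu := (@lebesgue_measure R).
Implicit Types f g : R -> \bar R.

Lemma measurable_negpow (s : R) : measurable_fun setT (@negpow R s).
Proof.
rewrite (_ : negpow s = fun y => if y == +oo then 0 else if y == -oo then +oo
    else phi_neg s (fine y)); last by apply/funext => -[].
apply: measurable_fun_ifT => //; first exact: measurable_fun_eqe.
apply: measurable_fun_ifT => //; first exact: measurable_fun_eqe.
apply: (measurableT_comp (measurable_phi_neg s)).
exact: (fine_measurable measurableT).
Qed.

Lemma measurable_lne : measurable_fun setT (@lne R).
Proof.
rewrite (_ : @lne R = fun y => if y == +oo then +oo else if y == -oo then -oo
    else if (fine y <= 0)%R then -oo else (ln (fine y))%:E); last by apply/funext => -[].
apply: measurable_fun_ifT => //; first exact: measurable_fun_eqe.
apply: measurable_fun_ifT => //; first exact: measurable_fun_eqe.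
have mfine : measurable_fun setT (@fine R) by exact: (fine_measurable measurableT).
apply: measurable_fun_ifT => //; first exact: measurable_fun_ler.
by apply/measurable_EFinP; exact: (measurableT_comp (@measurable_ln R)).
Qed.

Section interval.
Variables a b : R.
Hypothesis ab : (a < b)%R.

Lemma avgZ f (k : R) : (0 <= k)%R -> measurable_fun setT f ->
  (forall x, 0 <= f x) -> avg (fun x => k%:E * f x) a b = k%:E * avg f a b.
Proof.
move=> k0 mf f0; rewrite /avg /integ ge0_integralZl_EFin//; last exact: measurable_funTS.
by rewrite muleCA.
Qed.

Lemma avg_cst (r : \bar R) : avg (cst r) a b = r.
Proof.
rewrite /avg /integ integral_cst//= lebesgue_measure_itv/= lte_fin ab -EFinB.
by rewrite muleCA -EFinM mulVf ?mule1// gt_eqF// subr_gt0.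
Qed.

Lemma eq_ae_avg f g : measurable_fun setT f -> measurable_fun setT g ->
  {ae mu, forall x, x \in `[a, b] -> f x = g x} -> avg f a b = avg g a b.
Proof.
move=> mf mg fg; rewrite /avg /integ; congr (_ * _).
by apply: ae_eq_integral => //; exact: measurable_funTS.
Qed.

Lemma eq_avg f g : f =1 g -> avg f a b = avg g a b.
Proof. by move=> /funext ->. Qed.

Lemma le_ae_avg f g : measurable_fun setT f -> measurable_fun setT g ->
  (forall x, 0 <= f x) -> (forall x, 0 <= g x) ->
  {ae mu, forall x, x \in `[a, b] -> f x <= g x} -> avg f a b <= avg g a b.
Proof.
move=> mf mg f0 g0 fg; rewrite /avg; apply: lee_wpmul2l.
  by rewrite lee_fin invr_ge0 subr_ge0 ltW.
by apply: ae_ge0_le_integral => //; exact: measurable_funTS.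
Qed.

Lemma avg_eq0_ae f : measurable_fun setT f -> (forall x, 0 <= f x) ->
  avg f a b <= 0 -> {ae mu, forall x, x \in `[a, b] -> f x = 0}.
Proof.
move=> mf f0 h; apply: ae_eq0_integral_itv => //; apply/eqP.
rewrite eq_le integ_ge0// andbT.
by move: h; rewrite /avg lee_pdivrMl ?subr_gt0// mule0.
Qed.

Lemma ae_eq0_avg f : measurable_fun setT f ->
  {ae mu, forall x, x \in `[a, b] -> f x = 0} -> avg f a b = 0.
Proof. by move=> mf h; rewrite (@eq_ae_avg f (cst 0))// avg_cst. Qed.

Lemma avg_lty f : (forall x, 0 <= f x) -> integ f a b < +oo ->
  avg f a b \is a fin_num.
Proof. by move=> f0 h; rewrite fin_numM// ge0_fin_numE// integ_ge0. Qed.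

Lemma ae_fin_num f : measurable_fun setT f -> (forall x, 0 <= f x) ->
  integ f a b < +oo -> {ae mu, forall x, x \in `[a, b] -> f x \is a fin_num}.
Proof.
move=> mf f0 foo.
have : mu.-integrable `[a, b]%classic f.
  by apply: ge0_integrable => //; exact: measurable_funTS.
by move=> /integrable_ae h; exact: h.
Qed.

Lemma ae_and (P P' : R -> Prop) : {ae mu, forall x, P x} ->
  {ae mu, forall x, P' x} -> {ae mu, forall x, P x /\ P' x}.
Proof.
by apply: filterS2 => //; exact: (ae_filter_ringOfSetsType mu).
Qed.

(* A weight that vanishes on [a, b] makes the dual factor infinite. *)
Lemma avg_gt0 (u : R -> R) (h : R -> \bar R) :
  measurable_fun setT u -> (forall x, 0 <= u x)%R -> measurable_fun setT h ->
  (forall x, u x = 0%R -> h x = +oo) -> avg h a b != +oo ->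
  0 < avg (EFin \o u) a b.
Proof.
move=> mu_ u0 mh hu hfin.
have mU : measurable_fun setT (EFin \o u) by exact/measurable_EFinP.
have U0 x : 0 <= (EFin \o u) x by rewrite lee_fin.
rewrite lt_neqAle avg_ge0 ?ltW// andbT eq_sym; apply: contra hfin => /eqP e0.
have {}e0 : avg (EFin \o u) a b <= 0 by rewrite e0.
rewrite (@eq_ae_avg _ (cst +oo))// ?avg_cst//.
by apply: ae_impl (avg_eq0_ae mU U0 e0) => x h1 xI; apply: hu; have [] := h1 xI.
Qed.

End interval.
End Averages.

(** * From a characteristic on one interval to the average of its test function *)

Section DyadicBounds.
Context {R : realType}.
Local Notation mu := (@lebesgue_measure R).
Variables (a b : R) (u : R -> R) (D m V : R).
Hypotheses (ab : (a < b)%R) (mu_ : measurable_fun setT u) (u0 : forall x, (0 <= u x)%R).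
Hypothesis uoo : integ (EFin \o u) a b < +oo.
Hypotheses (D0 : (0 < D)%R) (m0 : (0 < m)%R).
Local Notation A := (avg (EFin \o u) a b).

Let mU : measurable_fun setT (EFin \o u). Proof. exact/measurable_EFinP. Qed.
Let U0 x : 0 <= (EFin \o u) x. Proof. by rewrite lee_fin. Qed.
Let Afin : A \is a fin_num. Proof. exact: avg_lty. Qed.
Let A0 : 0 <= A. Proof. by apply: avg_ge0 => //; exact: ltW. Qed.

Lemma Ap_avg_gt0 (r : R) : (1 < r)%R ->
  Apchar r%:E (EFin \o u) a b <= V%:E -> 0 < A.
Proof.
move=> r1; rewrite /Apchar gt_eqF//; case: ifPn => // Nn _.
apply: (avg_gt0 ab mu_ u0) Nn.
  exact: (measurableT_comp (measurable_negpow _)).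
by move=> x /= ->; rewrite eqxx.
Qed.

(** With s = 1/(r-1) and N the average of u^(-s), homogeneity gives m^s N = (m N^(r-1))^s; then m <=
    D A and A N^(r-1) <= V. *)
Lemma Ap_dyadic (r : R) : (1 < r)%R ->
  Apchar r%:E (EFin \o u) a b <= V%:E -> m%:E <= D%:E * A ->
  avg (fun x => phi_neg (r - 1)^-1 (u x / m)) a b <= ((D * V) `^ (r - 1)^-1)%:E.
Proof.
move=> r1; rewrite /Apchar gt_eqF//; set s := (r - 1)^-1%R.
have s0 : (0 < s)%R by rewrite invr_gt0 subr_gt0.
have rs : ((r - 1) * s = 1)%R by rewrite mulfV// gt_eqF// subr_gt0.
have mN : measurable_fun setT (fun x => negpow s ((EFin \o u) x)).
  exact: (measurableT_comp (measurable_negpow _)).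
have N0 x : 0 <= negpow s ((EFin \o u) x) by exact: phi_neg_ge0.
have -> : avg (fun x => phi_neg s (u x / m)) a b =
    (m `^ s)%:E * avg (fun x => negpow s ((EFin \o u) x)) a b.
  rewrite -avgZ ?powR_ge0//; apply: eq_avg => x; rewrite /phi_neg /=.
  rewrite mulf_eq0 invr_eq0 (gt_eqF m0) orbF; case: ifPn => ux.
    by rewrite gt0_muley// lte_fin powR_gt0.
  rewrite -EFinM; congr (_%:E); rewrite powRM ?invr_ge0 ?(ltW m0)// mulrC.
  by rewrite -[(m^-1)%R]powR_inv1 ?(ltW m0)// -powRrM mulrNN mul1r.
case: ifPn => // Nn.
set N := avg _ a b in Nn *.
have Nge0 : 0 <= N by apply: avg_ge0 => //; exact: ltW.
have Nfin : N \is a fin_num by rewrite ge0_fin_numE// ltey.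
have fN : (0 <= fine N)%R := fine_ge0 Nge0.
have fA : (0 <= fine A)%R := fine_ge0 A0.
rewrite -(fineK Afin) -(fineK Nfin) /= -!EFinM !lee_fin => h1 h2.
apply: (@le_trans _ _ ((D * fine A * fine N `^ (r - 1)) `^ s)%R).
  rewrite powRM ?mulr_ge0 ?powR_ge0 ?(ltW D0)// -powRrM rs powRr1//.
  apply: ler_wpM2r => //; apply: ge0_ler_powR => //; rewrite ?nnegrE ?(ltW s0) ?(ltW m0)//.
  by rewrite mulr_ge0// ltW.
apply: ge0_ler_powR; rewrite ?nnegrE ?(ltW s0)//.
- by rewrite !mulr_ge0 ?powR_ge0// ltW.
- by rewrite mulr_ge0 ?(ltW D0)//; apply: le_trans h1; rewrite mulr_ge0 ?powR_ge0.
- by rewrite -mulrA ler_pM2l.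
Qed.

Lemma A1_ae : Apchar 1 (EFin \o u) a b <= V%:E ->
  {ae mu, forall x, x \in `[a, b] -> (0 < u x /\ fine A <= V * u x)%R}.
Proof.
rewrite /Apchar eqxx; set i := essinf _ _ _; case: ifPn => // i_neq0 h.
have i0 : 0 < i.
  rewrite lt_neqAle eq_sym i_neq0 /=; apply/ess_infP; apply: aeW => x.
  by case: ifP.
have : {ae mu, forall x, i <= (if x \in `[a, b] then (EFin \o u) x else +oo)}.
  exact: ess_inf_le.
apply: ae_impl => x + xab; rewrite xab => iu.
have u_gt0 : (0 < u x)%R by rewrite -lte_fin; exact: lt_le_trans iu.
split => //.
case: i i0 iu h {i_neq0} => [i| |]//= i0 iu.
rewrite gt_eqF; last by rewrite -lte_fin.
rewrite lte_fin in i0; rewrite lee_fin in iu.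
rewrite muleC lee_pdivrMl// muleC -(fineK Afin) -EFinM lee_fin => h.
have Vi : (0 <= V * i)%R by apply: (le_trans _ h); exact: fine_ge0.
by apply: (le_trans h); apply: ler_wpM2l => //; rewrite -(pmulr_lge0 _ i0).
Qed.

Lemma A1_avg_gt0 : Apchar 1 (EFin \o u) a b <= V%:E -> 0 < A.
Proof.
move=> /A1_ae h; rewrite lt_neqAle A0 andbT eq_sym; apply/eqP => A_eq0.
have A_le0 : A <= 0 by rewrite A_eq0.
have := ae_and h (avg_eq0_ae ab mU U0 A_le0).
(* Almost every point of [a, b] is now contradictory. As [a, b] has positive length, comparing the
   averages of the constants 1 and 0 makes this a contradiction. *)
move=> h2; have : 1 <= (0 : \bar R); last by rewrite lee_fin ler10.
rewrite -[leLHS](avg_cst ab) -[leRHS](avg_cst ab).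
apply: le_ae_avg => //.
by apply: ae_impl h2 => x [h3 h4] xab; have [+ _] := h3 xab;
  have [->] := h4 xab; rewrite ltxx.
Qed.

(** Almost everywhere m <= D A <= D V u, so u / m never falls below the hinge point 1/(D V). *)
Lemma A1_dyadic : (0 < V)%R -> Apchar 1 (EFin \o u) a b <= V%:E -> m%:E <= D%:E * A ->
  avg (fun x => (Num.max (-1 * (u x / m) + (D * V)^-1) 0)%:E) a b <= 0.
Proof.
move=> V0 /A1_ae h; rewrite -(fineK Afin) -EFinM lee_fin => mA.
rewrite ae_eq0_avg//.
  apply: (measurableT_comp (@measurable_max_affine R (-1) _)).
  exact: measurable_funM.
apply: ae_impl h => x /[apply] -[ux h]; congr (_%:E); apply: max_r.
rewrite mulN1r addrC subr_le0 ler_pdivlMr// mulrC ler_pdivrMr ?mulr_gt0//.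
by apply: (le_trans mA); rewrite mulrCA ler_pM2l// mulrC.
Qed.

(** Homogeneity turns the average into m^(-r) X with X^(1/r) <= V A <= |V| D m. The absolute value
    is there because V may have any sign. *)
Lemma RHp_dyadic (r : R) : (1 < r)%R ->
  RHbound r%:E V (EFin \o u) a b -> A <= (D * m)%:E ->
  avg (fun x => ((u x / m) `^ r)%:E) a b <= ((`|V| * D) `^ r)%:E.
Proof.
move=> r1 /= h Am.
have r0 : (0 < r)%R by lra.
have mP : measurable_fun setT (fun x => poweR ((EFin \o u) x) r).
  exact: (measurableT_comp (measurable_poweR r)).
have P0 x : 0 <= poweR ((EFin \o u) x) r by exact: poweR_ge0.
have -> : avg (fun x => ((u x / m) `^ r)%:E) a b =
    (m `^ (- r))%:E * avg (fun x => poweR ((EFin \o u) x) r) a b.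
  rewrite -avgZ ?powR_ge0//; apply: eq_avg => x /=.
  rewrite -EFinM; congr (_%:E); rewrite powRM ?invr_ge0 ?(ltW m0)// mulrC.
  by rewrite -[(m^-1)%R]powR_inv1 ?(ltW m0)// -powRrM mulN1r.
move: h; set X := avg (fun _ => poweR _ _) a b => h.
have X0 : 0 <= X by apply: avg_ge0 => //; exact: ltW.
have Xfin : X \is a fin_num.
  rewrite ge0_fin_numE// (@lty_poweRy _ _ r^-1)// ?invr_eq0 ?gt_eqF//.
  by apply: le_lt_trans h _; rewrite -(fineK Afin) -EFinM ltry.
have fX : (0 <= fine X)%R := fine_ge0 X0.
have fA : (0 <= fine A)%R := fine_ge0 A0.
move: h Am; rewrite -(fineK Afin) -(fineK Xfin) /= -!EFinM !lee_fin => h1 h2.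
have h3 : (fine X `^ r^-1 <= `|V| * D * m)%R.
  apply: le_trans h1 _; rewrite -mulrA.
  apply: (@le_trans _ _ (`|V| * fine A)%R); last by apply: ler_wpM2l.
  by apply: ler_wpM2r => //; exact: ler_norm.
have VD0 : (0 <= `|V| * D)%R by rewrite mulr_ge0// ltW.
have h4 : (fine X <= (`|V| * D) `^ r * m `^ r)%R.
  rewrite -powRM ?(ltW m0)// -[leLHS]powRr1// -(mulVf (x := r)) ?gt_eqF// powRrM.
  apply: ge0_ler_powR => //; rewrite ?nnegrE ?powR_ge0 ?(ltW r0)//.
  by rewrite mulr_ge0// ltW.
by rewrite powRN mulrC ler_pdivrMr// powR_gt0.
Qed.

Lemma RHoo_dyadic : RHbound +oo V (EFin \o u) a b -> A <= (D * m)%:E ->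
  avg (fun x => (Num.max (1 * (u x / m) + - (`|V| * D)) 0)%:E) a b <= 0.
Proof.
rewrite /RHbound /esssup => /ess_supP h; rewrite -(fineK Afin) lee_fin => Am.
rewrite ae_eq0_avg//.
  apply: (measurableT_comp (@measurable_max_affine R 1 _)).
  exact: measurable_funM.
apply: ae_impl h => x + xab; rewrite xab -(fineK Afin) lee_fin => h.
congr (_%:E); apply: max_r.
rewrite mul1r subr_le0 ler_pdivrMr//.
apply: le_trans h _; rewrite -mulrA.
apply: (@le_trans _ _ (`|V| * fine A)%R); last by apply: ler_wpM2l.
by apply: ler_wpM2r; [exact: fine_ge0|exact: ler_norm].
Qed.

End DyadicBounds.

(** * Integrability of the logarithm, for A_oo *)

Section LogAverage.
Context {R : realType}.
Local Notation mu := (@lebesgue_measure R).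

(** The negative part of k is at most |v|, hence has finite integral; an integral of k other than
    +oo then forces the positive part to be finite too. It is applied to k = - ln u, where
    nonnegativity of [phi_log] supplies the minorant. *)
Lemma integrable_minorized d (T : measurableType d) (nu : {measure set T -> \bar R})
    (D : set T) (k v : T -> \bar R) :
  measurable D -> measurable_fun D k -> nu.-integrable D v ->
  (forall x, D x -> - v x <= k x) -> \int[nu]_(x in D) k x != +oo ->
  nu.-integrable D k.
Proof.
move=> mD mk iv vk kn.
have mkp := measurable_funepos mk; have mkn := measurable_funeneg mk.
have nfin : \int[nu]_(x in D) k^\- x < +oo.
  move/integrableP: iv => [mv]; apply: le_lt_trans.
  apply: ge0_le_integral => //; first exact: measurableT_comp.
  move=> x Dx; rewrite funenegE ge_max abse_ge0 andbT.
  by apply: (le_trans _ (lee_abs _)); rewrite leeNl vk.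
have n0 : 0 <= \int[nu]_(x in D) k^\- x by exact: integral_ge0.
have pfin : \int[nu]_(x in D) k^\+ x < +oo.
  rewrite ltey; apply: contra kn => /eqP e; rewrite integralE e.
  by rewrite addye// eqe_oppLR/= lt_eqF.
apply/integrableP; split => //; rewrite -[fun x => _]/(abse \o k) fune_abse.
by rewrite ge0_integralD// lte_add_pinfty.
Qed.

Lemma phi_log_lne (y m : R) : (0 <= y)%R -> (0 < m)%R ->
  phi_log (y / m) = (m^-1 * y)%:E + (-1 + ln m)%:E - lne y%:E.
Proof.
move=> y0 m0; rewrite /phi_log mulf_eq0 invr_eq0 (gt_eqF m0) orbF.
have [->|yn0] := eqVneq y 0%R; first by rewrite /= lexx.
have yp : (0 < y)%R by rewrite lt_neqAle eq_sym yn0.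
rewrite lne_EFin// -!EFinD; congr (_%:E).
by rewrite ln_div ?posrE// [(m^-1 * y)%R]mulrC; lra.
Qed.

Variables (a b : R) (u : R -> R) (m : R).
Hypotheses (ab : (a < b)%R) (mu_ : measurable_fun setT u) (u0 : forall x, (0 <= u x)%R).
Hypothesis uoo : integ (EFin \o u) a b < +oo.
Hypothesis m0 : (0 < m)%R.
Local Notation A := (avg (EFin \o u) a b).
Local Notation I := (`[a, b]%classic : set R).

Let mU : measurable_fun setT (EFin \o u). Proof. exact/measurable_EFinP. Qed.
Let U0 x : 0 <= (EFin \o u) x. Proof. by rewrite lee_fin. Qed.
Let Afin : A \is a fin_num. Proof. exact: avg_lty. Qed.

Let k (x : R) : \bar R := - lne (u x)%:E.
Let v (x : R) : \bar R := (m^-1 * u x)%:E + (-1 + ln m)%:E.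

Let mk : measurable_fun setT k.
Proof.
apply: (measurableT_comp (@oppe_measurable R setT)).
exact: (measurableT_comp measurable_lne).
Qed.

Let iU : mu.-integrable I (EFin \o u).
Proof. by apply: ge0_integrable => //; exact: measurable_funTS. Qed.

Let iu : mu.-integrable I (fun x => (m^-1 * u x)%:E).
Proof.
have : mu.-integrable I (fun x => m^-1%:E * (EFin \o u) x) by exact: integrableZl.
by apply: eq_integrable => // x _; rewrite EFinM.
Qed.

Let ic : mu.-integrable I (cst (-1 + ln m)%:E).
Proof.
apply/integrableP; split => //.
rewrite (_ : (fun x => _) = cst `|(-1 + ln m)%:E|)// integral_cst//=.
by rewrite lebesgue_measure_itv/= lte_fin ab -EFinB -EFinM ltry.
Qed.

Let iv : mu.-integrable I v.
Proof. exact: integrableD. Qed.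

Lemma avg_phi_log_lne : mu.-integrable I k ->
  avg k a b \is a fin_num /\
  avg (fun x => phi_log (u x / m)) a b = (fine A / m - 1 + ln m)%:E + avg k a b.
Proof.
move=> ik.
have kfin : \int[mu]_(x in I) k x \is a fin_num by exact: integrable_fin_num.
split; first by rewrite fin_numM.
rewrite /avg /integ; under eq_integral do rewrite phi_log_lne//.
rewrite integralD// integralD//.
rewrite -[X in _ + X + _]/(\int[mu]_(x in I) cst (-1 + ln m)%:E x) integral_cst//=.
rewrite lebesgue_measure_itv/= lte_fin ab -EFinB.
under eq_integral do rewrite EFinM.
rewrite integralZl//.
have Ufin : \int[mu]_(x in `[a, b]) (u x)%:E \is a fin_num by exact: integrable_fin_num.
rewrite -(fineK Ufin) -(fineK kfin) -!EFinM -!EFinD; congr (_%:E) => /=.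
have ba : (b - a)%R != 0%R by rewrite gt_eqF// subr_gt0.
by field; rewrite ba gt_eqF.
Qed.

Lemma integrable_lne : avg k a b != +oo -> mu.-integrable I k.
Proof.
move=> kn; apply: (@integrable_minorized _ (measurableTypeR R) mu _ _ v) => //.
- exact: measurable_funTS.
- move=> x _; have : 0 <= phi_log (u x / m) by apply: phi_log_ge0; rewrite divr_ge0// ltW.
  by rewrite phi_log_lne// -/(v x) -leeBlDl// sub0e.
- apply: contra kn => /eqP e; rewrite /avg /integ e.
  by rewrite gt0_muley// lte_fin invr_gt0 subr_gt0.
Qed.

(** Here - ln u is the difference of [phi_log (u / m)] and v, both integrable. This is the route
    back from a bound on the test function. *)
Lemma integrable_lne_phi (K : R) :
  avg (fun x => phi_log (u x / m)) a b <= K%:E -> mu.-integrable I k.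
Proof.
move=> hK.
have mh : measurable_fun setT (fun x => phi_log (u x / m)).
  apply: (measurableT_comp measurable_phi_log); exact: measurable_funM.
have h0 x : 0 <= phi_log (u x / m) by apply: phi_log_ge0; rewrite divr_ge0// ltW.
have ih : mu.-integrable I (fun x => phi_log (u x / m)).
  apply: ge0_integrable => //; first exact: measurable_funTS.
  move: hK; rewrite /avg lee_pdivrMl ?subr_gt0// => /le_lt_trans; apply.
  by rewrite -EFinM ltry.
have : mu.-integrable I ((fun x => phi_log (u x / m)) \- v) by exact: integrableB.
apply: eq_integrable => // x _.
by rewrite /= phi_log_lne// -/(v x) -/(k x) addeAC subee// add0e.
Qed.

End LogAverage.

Section LogDyadic.
Context {R : realType}.
Variables (a b : R) (u : R -> R) (D m V : R).
Hypotheses (ab : (a < b)%R) (mu_ : measurable_fun setT u) (u0 : forall x, (0 <= u x)%R).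
Hypothesis uoo : integ (EFin \o u) a b < +oo.
Hypotheses (D0 : (0 < D)%R) (m0 : (0 < m)%R).
Local Notation A := (avg (EFin \o u) a b).

Lemma Aoo_avg_gt0 : Apchar +oo (EFin \o u) a b <= V%:E -> 0 < A.
Proof.
rewrite /Apchar /=; case: ifPn => //; rewrite expeR_eqy => kn _.
apply: (avg_gt0 ab mu_ u0) kn.
  have mU : measurable_fun setT (EFin \o u) by exact/measurable_EFinP.
  exact: (measurableT_comp (@oppe_measurable R setT) (measurableT_comp measurable_lne mU)).
by move=> x ->; rewrite /= lexx.
Qed.

(** The average equals A/m - 1 + ln m + L, with L the average of - ln u. The three terms of the
    constant come from A/m <= D, ln m <= ln D + ln A and ln A + L <= ln V. *)
Lemma Aoo_dyadic : Apchar +oo (EFin \o u) a b <= V%:E ->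
  A <= (D * m)%:E -> m%:E <= D%:E * A ->
  avg (fun x => phi_log (u x / m)) a b <= (D + ln D + ln V)%:E.
Proof.
move=> hA; have A0 := Aoo_avg_gt0 hA; move: hA.
have Afin : A \is a fin_num by apply: avg_lty => // x; rewrite lee_fin.
rewrite /Apchar /=; case: ifPn => //; rewrite expeR_eqy => kn.
have [kfin ->] := avg_phi_log_lne ab mu_ u0 uoo m0 (integrable_lne ab mu_ u0 uoo m0 kn).
rewrite -(fineK Afin) in A0 *; rewrite lte_fin in A0.
rewrite -(fineK kfin) /= -!EFinM -EFinD !lee_fin => h1 h2 h3.
set B := fine A in A0 h1 h2 h3 *; set L := fine (avg (fun x => - lne (u x)%:E) a b) in h1 *.
have V0 : (0 < V)%R by apply: lt_le_trans h1; rewrite mulr_gt0// expR_gt0.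
have hL : (ln B + L <= ln V)%R.
  by rewrite -[L]expRK -lnM ?posrE ?expR_gt0// ler_ln ?posrE ?mulr_gt0 ?expR_gt0.
have hm : (ln m <= ln D + ln B)%R.
  by rewrite -lnM ?posrE// ler_ln ?posrE ?mulr_gt0.
have hB : (B / m <= D)%R by rewrite ler_pdivrMr.
by lra.
Qed.

End LogDyadic.

(** * From averages of test functions back to characteristics *)

Section Conclusions.
Context {R : realType}.
Local Notation mu := (@lebesgue_measure R).
Variables (a b : R) (W : R -> \bar R) (M : R).
Hypotheses (ab : (a < b)%R) (mW : measurable_fun setT W) (W0 : forall x, 0 <= W x).
Hypothesis Woo : integ W a b < +oo.
Hypothesis M0 : (0 < M)%R.

(** W may be +oo on a null set, where [fine] returns 0; [Wfin] lets the averages of u and W be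
    identified. *)
Let u x := fine (W x).

Let mu_ : measurable_fun setT u.
Proof. exact: (measurableT_comp (fine_measurable measurableT)). Qed.

Let u0 x : (0 <= u x)%R.
Proof. by rewrite fine_ge0. Qed.

Let uM : measurable_fun setT (fun x => u x / M)%R.
Proof. exact: measurable_funM. Qed.

Let uM0 x : (0 <= u x / M)%R.
Proof. by rewrite divr_ge0// ltW. Qed.

Let Wfin := ae_fin_num mW W0 Woo.

Lemma Ap_of_avg_phi (r K : R) : (1 < r)%R -> avg W a b = M%:E ->
  avg (fun x => phi_neg (r - 1)^-1 (fine (W x) / M)) a b <= K%:E ->
  Apchar r%:E W a b <= (K `^ (r - 1))%:E.
Proof.
move=> r1 WM; rewrite /Apchar gt_eqF//; set s := (r - 1)^-1%R => hK.
have s0 : (0 < s)%R by rewrite invr_gt0 subr_gt0.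
have rs : (s * (r - 1) = 1)%R by rewrite mulVf// gt_eqF// subr_gt0.
have mp : measurable_fun setT (fun x => phi_neg s (u x / M)).
  exact: (measurableT_comp (measurable_phi_neg s)).
have -> : avg (fun x => negpow s (W x)) a b =
    (M `^ (- s))%:E * avg (fun x => phi_neg s (u x / M)) a b.
  rewrite -avgZ ?powR_ge0// => [|x]; last exact: phi_neg_ge0.
  apply: eq_ae_avg => //.
  - exact: (measurableT_comp (measurable_negpow s)).
  - exact: measurable_funeM.
  apply: ae_impl Wfin => x /[apply] Wx; rewrite -[in LHS](fineK Wx) -/(u x).
  rewrite /phi_neg /= mulf_eq0 invr_eq0 (gt_eqF M0) orbF; case: ifPn => ux.
    by rewrite gt0_muley// lte_fin powR_gt0.
  rewrite -EFinM; congr (_%:E); rewrite powRM ?invr_ge0 ?(ltW M0)// mulrCA.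
  rewrite -powRM ?invr_ge0 ?(ltW M0)// mulfV ?gt_eqF// powR1 mulr1//.
move: hK; rewrite -/(u _); set X := avg _ a b => hK.
have X0 : 0 <= X by apply: avg_ge0 => [x|]; [exact: phi_neg_ge0|exact: ltW].
have Xfin : X \is a fin_num by rewrite ge0_fin_numE// (le_lt_trans hK)// ltry.
have fX : (0 <= fine X)%R := fine_ge0 X0.
rewrite WM -(fineK Xfin) -EFinM /= -EFinM lee_fin.
rewrite -(fineK Xfin) lee_fin in hK.
rewrite powRM ?powR_ge0// -powRrM mulNr rs powR_inv1 ?(ltW M0)// mulVKf ?gt_eqF//.
apply: ge0_ler_powR; rewrite ?nnegrE ?subr_ge0 ?(ltW r1)//.
exact: le_trans hK.
Qed.

Lemma A1_of_avg_phi (c : R) : (0 < c)%R -> avg W a b = M%:E ->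
  avg (fun x => (Num.max (-1 * (fine (W x) / M) + c) 0)%:E) a b <= 0 ->
  Apchar 1 W a b <= c^-1%:E.
Proof.
move=> c0 WM h; rewrite /Apchar eqxx.
have hi : (c * M)%:E <= essinf W a b.
  apply/ess_infP; apply: ae_impl (avg_eq0_ae ab _ _ h) => [x||x]; last first.
  - by rewrite lee_fin le_max lexx orbT.
  - exact: (measurableT_comp (@measurable_max_affine R (-1) c)).
  case: ifP => [xab /(_ isT)|_ _]; last exact: leey.
  move=> /eqP; rewrite eqe eq_le => /andP[+ _]; rewrite ge_max => /andP[+ _].
  rewrite mulN1r addrC subr_le0 ler_pdivlMr// => cM.
  have cM0 : (0 < c * M)%R by rewrite mulr_gt0.
  by case: (W x) (W0 x) cM => [y| |] //= _; rewrite ?leey// lee_fin.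
have cM0 : 0 < (c * M)%:E by rewrite lte_fin mulr_gt0.
have i0 := lt_le_trans cM0 hi.
rewrite gt_eqF// WM.
case: (essinf W a b) hi i0 => [i| |] //=; rewrite ?mule0 ?lee_fin ?invr_ge0 ?(ltW c0)//.
rewrite lte_fin => hi i0; rewrite gt_eqF// -EFinM lee_fin ler_pdivrMr//.
by rewrite mulrC ler_pdivlMr// mulrC.
Qed.

Lemma Aoo_of_avg_phi (K : R) : avg W a b = M%:E ->
  avg (fun x => phi_log (fine (W x) / M)) a b <= K%:E ->
  Apchar +oo W a b <= (expR K)%:E.
Proof.
move=> WM hK.
have mEu : measurable_fun setT (EFin \o u) by exact/measurable_EFinP.
have uW : avg (EFin \o u) a b = M%:E.
  rewrite -WM; apply: eq_ae_avg => //.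
  by apply: ae_impl Wfin => x /[apply] Wx; rewrite /= fineK.
have uoo : integ (EFin \o u) a b < +oo.
  move: uW; rewrite /avg; case: integ => [y _| |//]; first exact: ltry.
  by rewrite gt0_muley// lte_fin invr_gt0 subr_gt0.
have [kfin] := avg_phi_log_lne ab mu_ u0 uoo M0 (integrable_lne_phi ab mu_ u0 uoo M0 hK).
(* As M is the average itself, the affine part of [phi_log] averages to zero and only ln M plus the
   average of - ln u remains. *)
have -> : (fine (avg (EFin \o u) a b) / M - 1 + ln M = ln M)%R.
  by rewrite uW /= divff ?gt_eqF//; lra.
move=> e.
rewrite {}e -(fineK kfin) -EFinD lee_fin in hK.
rewrite /Apchar WM (_ : avg _ a b = avg (fun x => - lne (u x)%:E) a b); last first.
  apply: eq_ae_avg => //.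
  - exact: (measurableT_comp (@oppe_measurable R setT) (measurableT_comp measurable_lne mW)).
  - exact: (measurableT_comp (@oppe_measurable R setT) (measurableT_comp measurable_lne mEu)).
  by apply: ae_impl Wfin => x /[apply] Wx; rewrite fineK.
rewrite -(fineK kfin) /= -EFinM lee_fin -[X in (X * _)%R]lnK ?posrE// -expRD ler_expR.
exact: hK.
Qed.

(** M is not tied to the average of W, since it will be that average plus eps. *)
Lemma RHp_of_avg_phi (r K : R) : (1 < r)%R ->
  avg (fun x => ((fine (W x) / M) `^ r)%:E) a b <= K%:E ->
  poweR (avg (fun x => poweR (W x) r) a b) r^-1 <= (K `^ r^-1 * M)%:E.
Proof.
move=> r1; rewrite -[avg _ a b]/(avg (fun x => ((u x / M) `^ r)%:E) a b) => hK.
have r0 : (0 < r)%R by lra.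
have mp : measurable_fun setT (fun x => ((u x / M) `^ r)%:E).
  exact: (measurableT_comp (@measurable_EFin_powR R r)).
have -> : avg (fun x => poweR (W x) r) a b =
    (M `^ r)%:E * avg (fun x => ((u x / M) `^ r)%:E) a b.
  rewrite -avgZ ?powR_ge0// => [|x]; last by rewrite lee_fin powR_ge0.
  apply: eq_ae_avg => //.
  - exact: (measurableT_comp (measurable_poweR r)).
  - exact: measurable_funeM.
  apply: ae_impl Wfin => x /[apply] Wx; rewrite -[in LHS](fineK Wx) -/(u x) /=.
  rewrite -EFinM -powRM ?(ltW M0)//; congr (_ `^ _)%:E.
  by rewrite mulrC divfK// gt_eqF.
set X := avg (fun x => ((u x / M) `^ r)%:E) a b in hK *.
have X0 : 0 <= X by apply: avg_ge0 => [x|]; [rewrite lee_fin powR_ge0|exact: ltW].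
have Xfin : X \is a fin_num by rewrite ge0_fin_numE// (le_lt_trans hK)// ltry.
have fX : (0 <= fine X)%R := fine_ge0 X0.
rewrite -(fineK Xfin) -EFinM /= lee_fin.
rewrite -(fineK Xfin) lee_fin in hK.
rewrite powRM ?powR_ge0// -powRrM mulfV ?gt_eqF// powRr1 ?(ltW M0)// mulrC.
apply: ler_wpM2r; first exact: ltW.
apply: ge0_ler_powR; rewrite ?nnegrE ?invr_ge0 ?(ltW r0)//.
exact: le_trans hK.
Qed.

Lemma RHoo_of_avg_phi (c : R) :
  avg (fun x => (Num.max (1 * (fine (W x) / M) + - c) 0)%:E) a b <= 0 ->
  esssup W a b <= (c * M)%:E.
Proof.
move=> h; apply/ess_supP.
have mp : measurable_fun setT (fun x => (Num.max (1 * (u x / M) + - c) 0)%:E).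
  exact: (measurableT_comp (@measurable_max_affine R 1 (- c))).
have p0 x : 0 <= (Num.max (1 * (u x / M) + - c) 0)%:E.
  by rewrite lee_fin le_max lexx orbT.
apply: ae_impl (ae_and Wfin (avg_eq0_ae ab mp p0 h)) => x.
case: ifP => [xab|_ _]; last exact: leNye.
move=> [/(_ isT) Wx /(_ isT)/eqP].
rewrite eqe eq_le => /andP[+ _]; rewrite ge_max => /andP[+ _].
by rewrite mul1r subr_le0 ler_pdivrMr// -lee_fin /u fineK.
Qed.

End Conclusions.

(** Lets eps tend to 0 in the reverse Hoelder bounds. The proof takes e / (K + 1), as K may
    vanish. *)
Lemma lee_mul_eps (R : realType) (K : R) (x y : \bar R) : (0 <= K)%R -> 0 <= y ->
  (forall e : R, (0 < e)%R -> x <= K%:E * (y + e%:E)) -> x <= K%:E * y.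
Proof.
move=> K0 y0 h; apply/lee_addgt0Pr => e e0.
have K1 : (0 < K + 1)%R by lra.
have := h _ (divr_gt0 e0 K1); rewrite ge0_muleDr ?lee_fin ?divr_ge0 ?(ltW e0) ?(ltW K1)//.
move=> /le_trans; apply; apply: leeD => //.
by rewrite -EFinM lee_fin mulrCA ger_pMr// ler_pdivrMr//; lra.
Qed.

(** * The five cases, with explicit constants *)

Section Assembly.
Context {R : realType}.

Lemma dyl_lt_dyr k j : (dyl k j < dyr k j :> R)%R.
Proof. by rewrite -subr_gt0 dyrB invr_gt0 exprn_gt0. Qed.

Lemma dyr_le_dyl1 k j : (dyr k j <= dyl k j + 1 :> R)%R.
Proof. by rewrite -lerBlDl dyrB invf_le1 ?exprn_gt0// exprn_ege1//; lra. Qed.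

Lemma max_affine_ge0 (a b y : R) : 0 <= (Num.max (a * y + b) 0)%:E.
Proof. by rewrite lee_fin le_max lexx orbT. Qed.

Variables (C V : R) (w : R -> R -> R).
Hypothesis fam : family_hyp C w.
Local Notation D := (dyadic_cst C).
Local Notation om := (transl_avg w).

Let D0 : (0 < D)%R. Proof. by have := dyadic_cst_ge1 C; lra. Qed.

Let mw t := measurable_weight fam (t := t).
Let w0 t := weight_ge0 fam (t := t).

Let woo t (t01 : t \in `[0%R, 1%R]) k j :
  integ (EFin \o w t) (dyl k j) (dyr k j) < +oo.
Proof. by apply: (integ_weight_lty fam) => //; exact: dyr_le_dyl1. Qed.

Let mom := measurable_transl_avg fam.
Let om0 := transl_avg_ge0 fam.

Let omoo a l : (l <= 1)%R -> integ om a (a + l)%R < +oo.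
Proof. by move=> l1; apply: (integ_transl_avg_lty fam); rewrite lerD2l. Qed.

Lemma transl_avg_Ap (r : R) : (1 < r)%R ->
  (forall t, t \in `[0%R, 1%R] -> Apd_bound r%:E V (EFin \o w t)) ->
  Ap_bound r%:E ((4 * (D * V) `^ (r - 1)^-1) `^ (r - 1))%R om.
Proof.
move=> r1 h a l l0 l1.
have s0 : (0 < (r - 1)^-1)%R by rewrite invr_gt0 subr_gt0.
have [||M [M0 ME hM]] := @avg_phi_transl_avg R C w fam (phi_neg (r - 1)^-1)
  ((D * V) `^ (r - 1)^-1)%R 0%R a l (measurable_phi_neg _)
  (fun y _ => phi_neg_ge0 _ y) (affine_sup_phi_neg s0) (lexx _) l0 l1.
- move=> t t01 k j jk; rewrite adde0.
  by apply: (Ap_avg_gt0 (dyl_lt_dyr _ _) (mw t01) (w0 t01) r1); exact: h.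
- move=> t t01 k j jk m m0 _; rewrite adde0 => h2.
  by apply: (Ap_dyadic (dyl_lt_dyr _ _) (mw t01) (w0 t01) (woo t01 _ _) D0 m0 r1) => //; exact: h.
rewrite adde0 in ME.
by apply: Ap_of_avg_phi ME hM => //; rewrite ?ltrDl ?omoo.
Qed.

Lemma transl_avg_A1 :
  (forall t, t \in `[0%R, 1%R] -> Apd_bound 1 V (EFin \o w t)) ->
  Ap_bound 1 (D * (`|V| + 1))%R om.
Proof.
move=> h a l l0 l1.
(* V is an arbitrary real, while the hinge point 1/(D V) needs a positive bound; enlarging V to |V|
   + 1 provides one. *)
have V1 : (0 < `|V| + 1)%R by rewrite ltr_wpDl.
have c0 : (0 < (D * (`|V| + 1))^-1)%R by rewrite invr_gt0 mulr_gt0.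
have {}h t (t01 : t \in `[0%R, 1%R]) k j (jk : (j < 2 ^ k)%N) :
    Apchar 1 (EFin \o w t) (dyl k j) (dyr k j) <= (`|V| + 1)%:E.
  apply: (le_trans (h t t01 k j jk)); rewrite lee_fin.
  by have := ler_norm V; lra.
have [||M [M0 ME]] := @avg_phi_transl_avg R C w fam
  (fun y => (Num.max (-1 * y + (D * (`|V| + 1))^-1) 0)%:E)
  0%R 0%R a l (measurable_max_affine _ _) (fun y _ => max_affine_ge0 _ _ y) (@affine_sup_max R _ _) (lexx _) l0 l1.
- move=> t t01 k j jk; rewrite adde0.
  exact: (A1_avg_gt0 (dyl_lt_dyr _ _) (mw t01) (w0 t01) (woo t01 _ _) (h t t01 k j jk)).
- move=> t t01 k j jk m m0 _; rewrite adde0 => h2.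
  by apply: (A1_dyadic (dyl_lt_dyr _ _) (mw t01) (w0 t01) (woo t01 _ _) D0 m0 V1) => //; exact: h.
rewrite mulr0 => hM; rewrite adde0 in ME; rewrite -[X in _ <= X%:E]invrK.
by apply: A1_of_avg_phi ME hM => //; rewrite ?ltrDl ?omoo.
Qed.

Lemma transl_avg_Aoo :
  (forall t, t \in `[0%R, 1%R] -> Apd_bound +oo V (EFin \o w t)) ->
  Ap_bound +oo (expR (4 * (D + ln D + ln V)))%R om.
Proof.
move=> h a l l0 l1.
have [||M [M0 ME hM]] := @avg_phi_transl_avg R C w fam phi_log
  (D + ln D + ln V)%R 0%R a l measurable_phi_log phi_log_ge0
  (@affine_sup_phi_log R) (lexx _) l0 l1.
- move=> t t01 k j jk; rewrite adde0.
  by apply: (Aoo_avg_gt0 (dyl_lt_dyr _ _) (mw t01) (w0 t01)); exact: h.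
- move=> t t01 k j jk m m0 h1; rewrite adde0 => h2.
  by apply: (Aoo_dyadic (dyl_lt_dyr _ _) (mw t01) (w0 t01) (woo t01 _ _) D0 m0) => //; exact: h.
rewrite adde0 in ME.
by apply: Aoo_of_avg_phi ME hM => //; rewrite ?ltrDl ?omoo.
Qed.

Let avg_om_ge0 a l : (0 < l)%R -> 0 <= avg om a (a + l)%R.
Proof. by move=> l0; apply: avg_ge0 => //; rewrite lerDl ltW. Qed.

(* The shift by eps keeps the normalising averages positive when some weights vanish. *)
Let pos_eps (eps : R) : (0 < eps)%R -> forall t, t \in `[0%R, 1%R] ->
  forall k j, (j < 2 ^ k)%N -> 0 < avg (EFin \o w t) (dyl k j) (dyr k j) + eps%:E.
Proof.
move=> e0 t t01 k j _; apply: (@lt_le_trans _ _ eps%:E); first by rewrite lte_fin.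
apply: leeDr; apply: avg_ge0 => [x|]; last exact/ltW/dyl_lt_dyr.
by rewrite lee_fin w0.
Qed.

Lemma transl_avg_RHp (r : R) : (1 < r)%R ->
  (forall t, t \in `[0%R, 1%R] -> RHd_bound r%:E V (EFin \o w t)) ->
  RH_bound r%:E ((4 * (`|V| * D) `^ r) `^ r^-1)%R om.
Proof.
move=> r1 h a l l0 l1; rewrite /RHbound; apply: lee_mul_eps.
- exact: powR_ge0.
- exact: avg_om_ge0.
move=> eps e0.
have [|M [M0 ME hM]] := @avg_phi_transl_avg R C w fam (fun y => (y `^ r)%:E)
  ((`|V| * D) `^ r)%R eps a l (measurable_EFin_powR _) (fun y _ => powR_ge0 y r) (affine_sup_powR r1)
  (ltW e0) l0 l1 (pos_eps e0).
- move=> t t01 k j jk m m0 h1 _.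
  apply: (RHp_dyadic (dyl_lt_dyr _ _) (mw t01) (w0 t01) (woo t01 _ _) D0 m0 r1) => //.
  by have [+ _] := h t t01; exact.
rewrite ME -EFinM.
by apply: RHp_of_avg_phi hM => //; rewrite ?ltrDl ?omoo.
Qed.

Lemma transl_avg_RHoo :
  (forall t, t \in `[0%R, 1%R] -> RHd_bound +oo V (EFin \o w t)) ->
  RH_bound +oo (`|V| * D)%R om.
Proof.
move=> h a l l0 l1; rewrite /RHbound; apply: lee_mul_eps.
- by rewrite mulr_ge0// ltW.
- exact: avg_om_ge0.
move=> eps e0.
have [|M [M0 ME hM]] := @avg_phi_transl_avg R C w fam
  (fun y => (Num.max (1 * y + - (`|V| * D)) 0)%:E)
  0%R eps a l (measurable_max_affine _ _) (fun y _ => max_affine_ge0 _ _ y) (@affine_sup_max R _ _)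
  (ltW e0) l0 l1 (pos_eps e0).
- move=> t t01 k j jk m m0 h1 _.
  apply: (RHoo_dyadic (dyl_lt_dyr _ _) (mw t01) (w0 t01) (woo t01 _ _) m0) => //.
  by have [+ _] := h t t01; exact.
rewrite mulr0 in hM; rewrite ME -EFinM.
by apply: RHoo_of_avg_phi hM => //; rewrite ?ltrDl ?omoo.
Qed.

End Assembly.

Theorem mainTheorem6 (R : realType) :
  (forall (p : \bar R), 1 <= p ->
   forall Vpd Cdbl : R, exists K : R,
   forall w : R -> R -> R,
     family_hyp Cdbl w ->
     (forall t, t \in `[0%R, 1%R] -> Apd_bound p Vpd (EFin \o w t)) ->
     Ap_bound p K (transl_avg w)) /\
  (forall (p : \bar R), 1 < p ->
   forall Vpd Cdbl : R, exists K : R,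
   forall w : R -> R -> R,
     family_hyp Cdbl w ->
     (forall t, t \in `[0%R, 1%R] -> RHd_bound p Vpd (EFin \o w t)) ->
     RH_bound p K (transl_avg w)).
Proof.
split=> -[r| |] //; rewrite ?lee_fin ?lte_fin => r1 V C.
- have [->|rn1] := eqVneq r 1%R.
    by exists (dyadic_cst C * (`|V| + 1))%R => w fam h; exact: (transl_avg_A1 fam).
  have {}r1 : (1 < r)%R by rewrite lt_neqAle eq_sym rn1.
  exists ((4 * (dyadic_cst C * V) `^ (r - 1)^-1) `^ (r - 1))%R => w fam h.
  exact: (transl_avg_Ap fam).
- exists (expR (4 * (dyadic_cst C + ln (dyadic_cst C) + ln V)))%R => w fam h.
  exact: (transl_avg_Aoo fam).
- exists ((4 * (`|V| * dyadic_cst C) `^ r) `^ r^-1)%R => w fam h.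
  exact: (transl_avg_RHp fam).
- exists (`|V| * dyadic_cst C)%R => w fam h.
  exact: (transl_avg_RHoo fam).
Qed.
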